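(* As $n\to\infty$, $$\operatorname{lbp}(n)\le \frac12\cdot\frac{n}{\lg n}+O\!\left(\frac{n\cdot\lg\lg n}{\lg^2 n}\right),$$ and there is a biclique partition realizing this bound (for each $n$-vertex graph) in which the number of bicliques is $O(n^2/\lg^3 n)$. Furthermore, given a graph $G$ on $n$ vertices, such a biclique partition can be constructed deterministically in time $O(n^2)$.
   Context: All graphs are finite, simple and undirected; $\lg$ is the base-2 logarithm. A biclique of a graph $G$ is a (not necessarily induced) complete bipartite subgraph of $G$. A biclique partition of $G$ is a family of bicliques of $G$ whose edge sets partition $E(G)$. The local biclique partition number $\operatorname{lbp}(G)$ is the least natural number $\ell$ such that $G$ has a biclique partition in which every vertex of $G$ belongs to at most $\ell$ bicliques; $\operatorname{lbp}(n)$ is the maximum of $\operatorname{lbp}(G)$ over all graphs $G$ on $n$ vertices. A partition ''realizes the bound'' if every vertex belongs to at most the stated number of bicliques. Running times are in the standard word-RAM model with words of $\Theta(\lg n)$ bits. *)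

(* Defs.v *)
From mathcomp Require Import all_boot.

Set Implicit Arguments.
Unset Strict Implicit.
Unset Printing Implicit Defensive.

(* A finite simple graph on T, given by its edge set, a set of 2-subsets. *)
Definition sgraph (T : finType) :=
  {E : {set {set T}} | E \subset [set e : {set T} | #|e| == 2]}.

Definition edges (T : finType) (G : sgraph T) : {set {set T}} := val G.

Definition adj (T : finType) (G : sgraph T) (u v : T) : bool :=
  [set u; v] \in edges G.

(* The complete bipartite graph with sides b.1 and b.2. *)
Definition bipair (T : finType) : Type := ({set T} * {set T})%type.

Definition bverts (T : finType) (b : bipair T) : {set T} := b.1 :|: b.2.

Definition bedges (T : finType) (b : bipair T) : {set {set T}} :=
  [set [set u; v] | u in b.1, v in b.2].

Definition is_biclique (T : finType) (G : sgraph T) (b : bipair T) : bool :=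
  [&& b.1 != set0, b.2 != set0, [disjoint b.1 & b.2] & bedges b \subset edges G].

(* As bicliques have at least one edge, the disjointness condition also rules
   out that P contains both (A, B) and (B, A), which are the same subgraph. *)
Definition is_biclique_partition (T : finType) (G : sgraph T)
    (P : {set bipair T}) : bool :=
  [&& [forall b in P, is_biclique G b],
      [forall b in P, forall c in P,
         (b != c) ==> [disjoint bedges b & bedges c]]
    & \bigcup_(b in P) bedges b == edges G].

Definition load (T : finType) (P : {set bipair T}) (v : T) : nat :=
  #|[set b in P | v \in bverts b]|.

Definition lbp_at_most (T : finType) (G : sgraph T) (l : nat) : bool :=
  [exists P : {set bipair T},
     is_biclique_partition G P && [forall v, load P v <= l]].

Lemma lbp_at_most_ex (T : finType) (G : sgraph T) : exists l, lbp_at_most G l.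
Proof.
pose P : {set bipair T} :=
  [set ([set x.1], [set x.2]) | x in
    [set x : T * T | (enum_rank x.1 < enum_rank x.2) && adj G x.1 x.2]].
have bE (u v : T) : bedges ([set u], [set v]) = [set [set u; v]].
  apply/setP => e; rewrite inE; apply/imset2P/eqP => [[a b] | ->].
    by rewrite !inE /= => /eqP -> /eqP ->.
  by exists u v; rewrite ?inE.
exists (\max_v load P v); apply/existsP; exists P; apply/andP; split; last first.
  by apply/forallP => v; apply: leq_bigmax.
apply/and3P; split.
- apply/forall_inP => _ /imsetP[[u v] + ->]; rewrite inE /= => /andP[uv auv].
  rewrite /is_biclique bE sub1set -/(adj G u v) auv andbT /=.
  apply/and3P; split; [by apply/set0Pn; exists u; rewrite inE | | ].
    by apply/set0Pn; exists v; rewrite inE.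
  by rewrite disjoints1 inE; apply: contraTneq uv => ->; rewrite ltnn.
- apply/forall_inP => _ /imsetP[[u v] + ->]; rewrite inE /= => /andP[uv _].
  apply/forall_inP => _ /imsetP[[a b] + ->]; rewrite inE /= => /andP[ab _].
  apply/implyP; rewrite !bE disjoints1 inE; apply: contraNN => /eqP e.
  have := set21 u v; have := set22 u v; rewrite e !inE.
  case/orP => /eqP vE /orP[] /eqP uE; subst.
  + by rewrite ltnn in uv.
  + by have := ltn_trans uv ab; rewrite ltnn.
  + by [].
  + by rewrite ltnn in uv.
- apply/eqP/setP => e; apply/bigcupP/idP => [[_ /imsetP[[u v] + ->]] | eG].
    by rewrite inE bE inE /= => /andP[_ auv] /eqP ->.
  have := subsetP (valP G) e eG; rewrite inE => /cards2P[u [v [uv eE]]].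
  have := uv; rewrite -(inj_eq enum_rank_inj) neq_ltn.
  case/orP => lt.
    exists ([set u], [set v]); last by rewrite bE inE eE.
    by apply/imsetP; exists (u, v); rewrite // inE lt /adj -eE.
  exists ([set v], [set u]); last by rewrite bE inE eE setUC.
  by apply/imsetP; exists (v, u); rewrite // inE lt /adj setUC -eE.
Qed.

Definition lbp (T : finType) (G : sgraph T) : nat := ex_minn (lbp_at_most_ex G).

Definition lbpn (n : nat) : nat := \max_(G : sgraph 'I_n) lbp G.

(* A word RAM with w-bit words. A machine word is a natural number below 2 ^ w,
   arithmetic is modulo 2 ^ w, and every instruction takes one time unit. A
   program uses the finitely many registers that it mentions; the memory is
   addressed by words. *)
Definition trunc (w x : nat) : nat := x %% 2 ^ w.

Inductive binop :=
  OpAdd | OpSub | OpMul | OpDiv | OpMod | OpAnd | OpOr | OpXor | OpShl | OpShr.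

Definition eval_binop (w : nat) (o : binop) (x y : nat) : nat :=
  trunc w match o with
          | OpAdd => x + y
          | OpSub => x + 2 ^ w - y
          | OpMul => x * y
          | OpDiv => x %/ y
          | OpMod => x %% y
          | OpAnd => Nat.land x y
          | OpOr  => Nat.lor x y
          | OpXor => Nat.lxor x y
          | OpShl => x * 2 ^ y
          | OpShr => x %/ 2 ^ y
          end.

(* r, x, y, a are register numbers and l is a position in the program. *)
Inductive instr :=
  | IConst (r k : nat)              (* r := k *)
  | IOp (o : binop) (r x y : nat)   (* r := x o y *)
  | ILoad (r a : nat)               (* r := memory[a] *)
  | IStore (a r : nat)              (* memory[a] := r *)
  | IJeq (x y l : nat)              (* if x = y then goto l *)
  | IJlt (x y l : nat)              (* if x < y then goto l *)
  | IHalt.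

Definition program := seq instr.

Record config := Config { pc : nat; reg : nat -> nat; mem : nat -> nat }.

Definition upd (f : nat -> nat) (i v : nat) : nat -> nat :=
  fun j => if j == i then v else f j.

Definition fetch (p : program) (s : config) : instr := nth IHalt p (pc s).

Definition halted (p : program) (s : config) : bool :=
  if fetch p s is IHalt then true else false.

Definition step (w : nat) (p : program) (s : config) : config :=
  let: Config i r m := s in
  match fetch p s with
  | IConst x k => Config i.+1 (upd r x (trunc w k)) m
  | IOp o z x y => Config i.+1 (upd r z (eval_binop w o (r x) (r y))) m
  | ILoad x a => Config i.+1 (upd r x (m (r a))) m
  | IStore a x => Config i.+1 r (upd m (r a) (r x))
  | IJeq x y l => Config (if r x == r y then l else i.+1) r m
  | IJlt x y l => Config (if r x < r y then l else i.+1) r m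
  | IHalt => s
  end.

(* The input occupies the memory from address 0 on; everything else is 0. *)
Definition init (w : nat) (input : seq nat) : config :=
  Config 0 (fun=> 0) (fun a => trunc w (nth 0 input a)).

(* On halting, register 0 points to the output. *)
Definition has_output (w : nat) (s : config) (out : seq nat) : Prop :=
  reg s 0 + size out <= 2 ^ w /\
  forall i, i < size out -> mem s (reg s 0 + i) = nth 0 out i.

Definition runs_to (w : nat) (p : program) (input : seq nat) (t : nat)
    (out : seq nat) : Prop :=
  let s := iter t (step w p) (init w input) in halted p s /\ has_output w s out.

(* n followed by the adjacency matrix in row-major order, one entry per word. *)
Definition graph_code (n : nat) (G : sgraph 'I_n) : seq nat :=
  n :: [seq nat_of_bool (adj G u v) | u <- enum 'I_n, v <- enum 'I_n].

(* The number of bicliques; then for every biclique the sizes of its two sides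
   followed by the vertices of the first side and those of the second side.
   The order of the bicliques and of the vertices in each side is free. *)
Definition bicliques_code (n : nat) (L : seq (seq 'I_n * seq 'I_n)) : seq nat :=
  size L :: flatten [seq size b.1 :: size b.2 :: map val (b.1 ++ b.2) | b <- L].

Definition lists_bicliques (n : nat) (L : seq (seq 'I_n * seq 'I_n))
    (P : {set bipair 'I_n}) : bool :=
  all (fun b => uniq b.1 && uniq b.2) L &&
  perm_eq [seq ([set x in b.1], [set x in b.2]) | b <- L] (enum P).

Definition computes_partition (n w : nat) (p : program) (G : sgraph 'I_n)
    (t : nat) (P : {set bipair 'I_n}) : Prop :=
  exists2 L, lists_bicliques L P &
             runs_to w p (graph_code G) t (bicliques_code L).

(* The real analysis library is loaded only here because its classical sets
   shadow the finite sets used above. *)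
From mathcomp Require Import all_order all_algebra.
From mathcomp Require Import all_classical all_reals all_analysis.

Definition lg (R : realType) (x : R) : R := (ln x / ln 2)%R.

(* Main.v *)
Require Import Defs.
From mathcomp Require Import all_boot zify.

Set Implicit Arguments.
Unset Strict Implicit.
Unset Printing Implicit Defensive.

(** The vertices 0, ..., n - 1 are cut into k intervals, the groups, of s
consecutive vertices each. Fix a group i. Every vertex v has a signature with
respect to i: the set of its neighbors in i, read as an s-bit number. The
vertices with signature M form one side of a biclique whose other side is the
set of vertices of i that M describes; there are K = 2 ^ s such cells (i, M) for
each group, and together they cover every edge that has an end in i. A vertex v
then belongs to at most one cell per group as a bearer of a signature, and to at
most K cells, those of its own group, as a member of a described set.

If every edge were covered from both ends it would be covered twice, so each
edge is first oriented, and the signature of v with respect to i records only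
the arcs from i to v. Orienting all edges from smaller to larger groups would
leave a vertex of the last group with k cells; the orientation is balanced
instead. Between two groups all edges point the same way, which depends on the
parity of the sum of the group numbers, so that about half of the k groups send
arcs to a given vertex ([right_load]). Within a group an edge points from the
larger vertex to the smaller one. The orientation is antisymmetric, and an arc
from u to v determines its cell: the group of u and the signature of v. Hence
the occupied cells are a biclique partition ([signature_partitionP]) with loads
at most K + k / 2 + 2 ([load_signature_partition]) and at most k K bicliques.
With l the integer logarithm of n and s = l + 1 - 2 log l, the number K is
O(n / lg^2 n) and k / 2 is n / (2 lg n) + O(n lg lg n / lg^2 n), which gives the
asymptotic bounds ([load_error_bigO], [count_bound_bigO]).

The program replaces the adjacency matrix by the oriented one in place, pushes
every vertex into the bucket of its cell for every group, and copies the
occupied cells to the output. The buckets lie in a table whose rows are so far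
apart that none can overflow into the next one; the memory is initially zero, so
the table starts out empty at no cost. Reading the signatures takes s steps for
each of k n pairs, and k s is at most 2 n; listing the described sets takes at
most s steps for each of k K cells, and K is at most 2 n; copying the buckets
takes k n steps in total. All of this is O(n^2) ([main_program_runs]). The
program is written in a small structured language with a compiler to the word
RAM and rules that bound running times compositionally. *)

(** * Structured programs for the word RAM *)

(** The registers and the memory; positions in the code are hidden. *)
Definition state : Type := ((nat -> nat) * (nat -> nat))%type.

(** [While x y c] repeats [c] as long as register [x] is below register [y], and
[IfLt x y c] runs [c] at most once under the same test. The counters of a loop
are advanced by its body. *)
Inductive cmd :=
  | Blk of seq instr
  | Seq of cmd & cmd
  | While of nat & nat & cmd
  | IfLt of nat & nat & cmd.

Definition straight (a : instr) : bool :=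
  match a with IJeq _ _ _ | IJlt _ _ _ | IHalt => false | _ => true end.

Definition exec1 (w : nat) (s : state) (a : instr) : state :=
  let: (r, m) := s in
  match a with
  | IConst x k => (upd r x (trunc w k), m)
  | IOp o z x y => (upd r z (eval_binop w o (r x) (r y)), m)
  | ILoad x a => (upd r x (m (r a)), m)
  | IStore a x => (r, upd m (r a) (r x))
  | _ => s
  end.

(** Jump targets are absolute, so the code of [c] depends on the position [i] at
which it is placed. An unconditional jump is a comparison of a register with
itself. *)
Fixpoint compile (i : nat) (c : cmd) : seq instr :=
  match c with
  | Blk l => l
  | Seq c1 c2 =>
      let p1 := compile i c1 in p1 ++ compile (i + size p1) c2
  | While x y c =>
      let b := compile i.+2 c in
      [:: IJlt x y i.+2, IJeq 0 0 (i.+3 + size b) & b ++ [:: IJeq 0 0 i]]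
  | IfLt x y c =>
      let b := compile i.+2 c in
      [:: IJlt x y i.+2, IJeq 0 0 (i.+2 + size b) & b]
  end.

Local Arguments step : simpl never.

Section Logic.
Variable w : nat.

(** The quantification over the surrounding code [p1] and [p2] makes the notion
independent of where [c] is placed, which is what composition needs. *)
Definition runs (c : cmd) (s : state) (t : nat) (s' : state) : Prop :=
  forall p1 p2, let p := p1 ++ compile (size p1) c ++ p2 in
  iter t (step w p) (Config (size p1) s.1 s.2) =
  Config (size p1 + size (compile (size p1) c)) s'.1 s'.2.

(** A weakest precondition with a time bound: from [s], the command reaches a
state in [Q] after at most [T] machine steps. *)
Definition wp (c : cmd) (T : nat) (Q : state -> Prop) (s : state) : Prop :=
  exists t s', [/\ t <= T, runs c s t s' & Q s'].

Lemma fetch_at p1 a p2 r m :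
  fetch (p1 ++ a :: p2) (Config (size p1) r m) = a.
Proof. by rewrite /fetch /= nth_cat ltnn subnn. Qed.

Lemma step_straight p1 a p2 s : straight a ->
  step w (p1 ++ a :: p2) (Config (size p1) s.1 s.2) =
  Config (size p1).+1 (exec1 w s a).1 (exec1 w s a).2.
Proof.
by case: s => r m; rewrite /step fetch_at; case: a.
Qed.

Lemma step_jeq p1 x y l p2 r m :
  step w (p1 ++ IJeq x y l :: p2) (Config (size p1) r m) =
  Config (if r x == r y then l else (size p1).+1) r m.
Proof.
by rewrite /step fetch_at.
Qed.

Lemma step_jlt p1 x y l p2 r m :
  step w (p1 ++ IJlt x y l :: p2) (Config (size p1) r m) =
  Config (if r x < r y then l else (size p1).+1) r m.
Proof.
by rewrite /step fetch_at.
Qed.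

Lemma wp_weaken c T T' (Q Q' : state -> Prop) s :
  T' <= T -> (forall s', Q' s' -> Q s') -> wp c T' Q' s -> wp c T Q s.
Proof.
move=> leT QQ' [t [s' [tT rs Qs]]]; exists t, s'; split=> //.
  exact: leq_trans leT.
exact: QQ'.
Qed.

Lemma wp_blk l (Q : state -> Prop) s :
  all straight l -> Q (foldl (exec1 w) s l) -> wp (Blk l) (size l) Q s.
Proof.
move=> sl Qs; exists (size l), (foldl (exec1 w) s l); split=> // p1 p2 /=.
elim: l s p1 sl {Qs} => [|a l IH] s p1 /=; first by rewrite addn0.
case/andP => sa sl; rewrite -iterS iterSr step_straight //.
by have := IH (exec1 w s a) (rcons p1 a) sl; rewrite size_rcons cat_rcons addnS.
Qed.

Lemma wp_seq c1 c2 T1 T2 (Q : state -> Prop) s :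
  wp c1 T1 (wp c2 T2 Q) s -> wp (Seq c1 c2) (T1 + T2) Q s.
Proof.
case=> t1 [s1 [le1 r1 [t2 [s2 [le2 r2 Qs]]]]].
exists (t2 + t1), s2; split=> //; first by lia.
move=> p1 p2 /=; rewrite iterD -catA r1.
have := r2 (p1 ++ compile (size p1) c1) p2.
by rewrite !size_cat -!catA /= => ->; rewrite addnA.
Qed.

Lemma wp_if x y c T (Q : state -> Prop) s :
  (s.1 x < s.1 y -> wp c T Q s) -> (s.1 y <= s.1 x -> Q s) ->
  wp (IfLt x y c) (T + 2) Q s.
Proof.
case: s => r m /= Hlt Hge; case: (ltnP (r x) (r y)) => [lt | ge].
  have [t [s' [tT rs Qs]]] := Hlt lt; exists t.+1, s'; split=> //; first by lia.
  move=> p1 p2 /=; rewrite -iterS iterSr step_jlt lt.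
  have := rs (p1 ++ [:: IJlt x y (size p1).+2;
    IJeq 0 0 ((size p1).+2 + size (compile (size p1).+2 c))]) p2.
  by rewrite !size_cat /= !addn2 -!catA /= => ->; rewrite !addnS !addSn.
exists 2, (r, m); split=> //; [by lia | | exact: Hge].
move=> p1 p2 /=; rewrite step_jlt ltnNge ge /=.
have := @step_jeq (rcons p1 (IJlt x y (size p1).+2)) 0 0
  ((size p1).+2 + size (compile (size p1).+2 c)) (compile (size p1).+2 c ++ p2) r m.
by rewrite size_rcons cat_rcons eqxx => ->; rewrite !addnS !addSn.
Qed.

(** The number [b] of rounds is known in advance and the invariant counts them.
Each round pays 2 steps for the test and the jump back, the exit 2 for the test
and the jump out. The cost [T j] may vary from round to round, which the copying
of buckets of different sizes requires. *)
Lemma wp_while x y c (I : nat -> state -> Prop) (T : nat -> nat) b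
    (Q : state -> Prop) s :
  I 0 s ->
  (forall j s', j < b -> I j s' -> s'.1 x < s'.1 y /\ wp c (T j) (I j.+1) s') ->
  (forall s', I b s' -> s'.1 y <= s'.1 x /\ Q s') ->
  wp (While x y c) (\sum_(0 <= j < b) (T j + 2) + 2) Q s.
Proof.
move=> I0 Ibody Iend.
suff loop d j s1 : j + d = b -> I j s1 ->
    wp (While x y c) (\sum_(j <= i < b) (T i + 2) + 2) Q s1 by exact: (loop b 0).
elim: d j s1 => [|d IH] j s1.
  rewrite addn0 => -> /Iend [ge Qs]; exists 2, s1; split=> //; first by lia.
  case: s1 ge {Qs} => r m /= ge p1 p2 /=; rewrite step_jlt ltnNge ge /=.
  have := @step_jeq (rcons p1 (IJlt x y (size p1).+2)) 0 0
    ((size p1).+3 + size (compile (size p1).+2 c))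
    ((compile (size p1).+2 c ++ [:: IJeq 0 0 (size p1)]) ++ p2) r m.
  rewrite size_rcons cat_rcons eqxx => ->.
  by rewrite size_cat /= !addnS !addSn addn0.
move=> jd Ij; have jb : j < b by lia.
have [lt [t1 [s2 [t1T r1 I2]]]] := Ibody _ _ jb Ij.
have [|t2 [s3 [t2T r2 Qs]]] := IH j.+1 s2 _ I2; first by lia.
exists (t2 + t1.+2), s3; split=> //.
  by rewrite big_ltn //; lia.
move=> p1 p2; set n1 := size p1; set b1 := compile n1.+2 c.
pose h := [:: IJlt x y n1.+2; IJeq 0 0 (n1.+3 + size b1)].
have sh : size (p1 ++ h) = n1.+2 by rewrite size_cat addn2.
have bE : compile (size (p1 ++ h)) c = b1 by rewrite sh.
pose p := p1 ++ compile n1 (While x y c) ++ p2.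
have pA : p = p1 ++ IJlt x y n1.+2 ::
  (IJeq 0 0 (n1.+3 + size b1) :: b1 ++ [:: IJeq 0 0 n1]) ++ p2 by [].
have pB : p = (p1 ++ h) ++ b1 ++ IJeq 0 0 n1 :: p2.
  by rewrite /p /= -/b1 /h -!catA /= -?catA.
have pC : p = ((p1 ++ h) ++ b1) ++ IJeq 0 0 n1 :: p2 by rewrite pB !catA.
have := r1 (p1 ++ h) (IJeq 0 0 n1 :: p2).
have := r2 p1 p2; rewrite /= bE sh -pB -/p => r2p r1p.
rewrite -/n1 -/p; clearbody p.
rewrite iterD iterS iterSr [in step w p (Config _ _ _)]pA step_jlt lt r1p.
rewrite [in step w p (Config _ _ _)]pC.
have -> : n1.+2 + size b1 = size ((p1 ++ h) ++ b1) by rewrite size_cat sh.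
by rewrite step_jeq eqxx.
Qed.

End Logic.

Lemma wp_while_const w x y c (I : nat -> state -> Prop) T b (Q : state -> Prop) s :
  I 0 s ->
  (forall j s', j < b -> I j s' -> s'.1 x < s'.1 y /\ wp w c T (I j.+1) s') ->
  (forall s', I b s' -> s'.1 y <= s'.1 x /\ Q s') ->
  wp w (While x y c) (b * (T + 2) + 2) Q s.
Proof.
move=> I0 Ib Ie; apply: wp_weaken (wp_while I0 (T := fun=> T) Ib Ie) => //.
by rewrite sum_nat_const_nat subn0.
Qed.

(** Symbolic execution: each lemma below runs the first instruction of a straight
block, with the operands already evaluated and with the machine operation
replaced by the exact one under the condition that nothing overflows. *)
Section Steps.
Variable w : nat.
Implicit Types (r m : nat -> nat) (l : seq instr) (Q : state -> Prop).

Lemma exec_const z k l r m Q : k < 2 ^ w ->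
  Q (foldl (exec1 w) (upd r z k, m) l) ->
  Q (foldl (exec1 w) (r, m) (IConst z k :: l)).
Proof. by move=> ?; rewrite /= /trunc modn_small. Qed.

Lemma exec_load z a l r m Q x : r a = x ->
  Q (foldl (exec1 w) (upd r z (m x), m) l) ->
  Q (foldl (exec1 w) (r, m) (ILoad z a :: l)).
Proof. by move=> <-. Qed.

Lemma exec_store a z l r m Q x y : r a = x -> r z = y ->
  Q (foldl (exec1 w) (r, upd m x y) l) ->
  Q (foldl (exec1 w) (r, m) (IStore a z :: l)).
Proof. by move=> <- <-. Qed.

Lemma exec_add z x y l r m Q a b : r x = a -> r y = b -> a + b < 2 ^ w ->
  Q (foldl (exec1 w) (upd r z (a + b), m) l) ->
  Q (foldl (exec1 w) (r, m) (IOp OpAdd z x y :: l)).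
Proof. by move=> <- <- lt; rewrite /= /eval_binop /trunc modn_small. Qed.

Lemma exec_sub z x y l r m Q a b : r x = a -> r y = b -> b <= a < 2 ^ w ->
  Q (foldl (exec1 w) (upd r z (a - b), m) l) ->
  Q (foldl (exec1 w) (r, m) (IOp OpSub z x y :: l)).
Proof.
move=> <- <- /andP[le lt]; rewrite /= /eval_binop /trunc addnC -addnBA //.
by rewrite modnDl modn_small //; apply: leq_ltn_trans lt; apply: leq_subr.
Qed.

Lemma exec_mul z x y l r m Q a b : r x = a -> r y = b -> a * b < 2 ^ w ->
  Q (foldl (exec1 w) (upd r z (a * b), m) l) ->
  Q (foldl (exec1 w) (r, m) (IOp OpMul z x y :: l)).
Proof. by move=> <- <- lt; rewrite /= /eval_binop /trunc modn_small. Qed.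

Lemma exec_div z x y l r m Q a b : r x = a -> r y = b -> a < 2 ^ w ->
  Q (foldl (exec1 w) (upd r z (a %/ b), m) l) ->
  Q (foldl (exec1 w) (r, m) (IOp OpDiv z x y :: l)).
Proof.
move=> <- <- lt; rewrite /= /eval_binop /trunc modn_small //.
exact: leq_ltn_trans (leq_div _ _) lt.
Qed.

Lemma exec_mod z x y l r m Q a b : r x = a -> r y = b -> a < 2 ^ w ->
  Q (foldl (exec1 w) (upd r z (a %% b), m) l) ->
  Q (foldl (exec1 w) (r, m) (IOp OpMod z x y :: l)).
Proof.
move=> <- <- lt; rewrite /= /eval_binop /trunc (@modn_small (_ %% _)) //.
exact: leq_ltn_trans (leq_mod _ _) lt.
Qed.

Lemma exec_shl z x y l r m Q a b : r x = a -> r y = b -> a * 2 ^ b < 2 ^ w ->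
  Q (foldl (exec1 w) (upd r z (a * 2 ^ b), m) l) ->
  Q (foldl (exec1 w) (r, m) (IOp OpShl z x y :: l)).
Proof. by move=> <- <- lt; rewrite /= /eval_binop /trunc modn_small. Qed.

End Steps.

(* Reads a register through the updates made so far in the block. *)
Ltac lookup := rewrite /upd /=;
  match goal with
  | H : ?r ?k = ?v |- ?r ?k = _ => exact: H
  | _ => reflexivity
  end.

(* Executes one instruction; leaves the absence of overflow as a side goal. *)
Ltac ins := match goal with |- context [foldl (exec1 _) _ (?a :: _)] =>
  match a with
  | IConst _ _ => apply: exec_const
  | ILoad _ _ => apply: exec_load; first by lookup
  | IStore _ _ => apply: exec_store; [by lookup | by lookup | ]
  | IOp OpAdd _ _ _ => apply: exec_add; [by lookup | by lookup | | ]
  | IOp OpSub _ _ _ => apply: exec_sub; [by lookup | by lookup | | ]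
  | IOp OpMul _ _ _ => apply: exec_mul; [by lookup | by lookup | | ]
  | IOp OpDiv _ _ _ => apply: exec_div; [by lookup | by lookup | | ]
  | IOp OpMod _ _ _ => apply: exec_mod; [by lookup | by lookup | | ]
  | IOp OpShl _ _ _ => apply: exec_shl; [by lookup | by lookup | | ]
  end end.

(** * Signatures, buckets and the emitted list *)

Lemma iotaSr m a : iota m a.+1 = rcons (iota m a) (m + a).
Proof. by rewrite -addn1 iotaD cats1. Qed.

(** The value of the bit string f 0, ..., f (b - 1), most significant bit first,
computed by the rule of Horner that the program follows. *)
Fixpoint bits_value (f : nat -> bool) (b : nat) : nat :=
  if b is b'.+1 then (bits_value f b').*2 + f b' else 0.

Lemma bits_value_lt f b : bits_value f b < 2 ^ b.
Proof. by elim: b => //= b IH; rewrite expnS; case: (f b); lia. Qed.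

Lemma bits_value_inj f g b : bits_value f b = bits_value g b -> forall i, i < b -> f i = g i.
Proof.
elim: b => //= b IH e i; rewrite ltnS leq_eqVlt => /orP[/eqP -> | ib].
  by move: e; case: (f b); case: (g b); lia.
by apply: IH => //; move: e; case: (f b); case: (g b); lia.
Qed.

Section Buckets.
Variables (n s k K : nat) (D : nat -> nat -> bool).

(** In this section [D u v] means that there is an arc from [u] to [v], [s] is the
size of a group, [k] the number of groups, and [K] the number of signatures. The
cell of group [i] and signature [M] has the number [i * K + M]. *)
Definition signature (i v : nat) : nat := bits_value (fun b => D (i * s + b) v) s.
(** The pair of group [i] and vertex [v] has the number [a = i * n + v], so that a
single loop runs through all pairs. *)
Definition destination (a : nat) : nat := (a %/ n) * K + signature (a %/ n) (a %% n).
Definition pushed (a c : nat) : seq nat :=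
  [seq e %% n | e <- iota 0 a & destination e == c].
Definition bucket (c : nat) : seq nat := pushed (k * n) c.
(** The vertices of the group that the signature describes. All members of a
bucket have the same signature, so the first one can be asked for its arcs in
place of decoding the signature. *)
Definition left_side (c : nat) : seq nat :=
  [seq u <- iota (c %/ K * s) s | D u (nth 0 (bucket c) 0)].
Definition occupied (c : nat) : bool := 0 < size (left_side c) * size (bucket c).
Definition sides_code (S B : seq nat) : seq nat := [:: size S, size B & S ++ B].
Definition occupied_cells (c : nat) : seq nat := [seq c' <- iota 0 c | occupied c'].
Definition emitted (c : nat) : seq nat :=
  flatten [seq sides_code (left_side c') (bucket c') | c' <- occupied_cells c].

Lemma pushedS a c :
  pushed a.+1 c = if destination a == c then rcons (pushed a c) (a %% n) else pushed a c.
Proof.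
rewrite /pushed iotaSr filter_rcons add0n; case: ifP => // _.
by rewrite map_rcons.
Qed.

Lemma size_pushed a c : size (pushed a c) <= a.
Proof. by rewrite size_map size_filter (leq_trans (count_size _ _)) ?size_iota. Qed.

Lemma destination_lt a : K = 2 ^ s -> a < k * n -> destination a < k * K.
Proof.
move=> KE lt; have n0 : 0 < n by case: (n) lt => //; rewrite muln0.
have : a %/ n < k by rewrite ltn_divLR.
have : signature (a %/ n) (a %% n) < K by rewrite KE bits_value_lt.
rewrite /destination; move: (a %/ n) (signature _ _) => i x xK ik.
by apply: leq_trans (_ : i.+1 * K <= _); [lia | rewrite leq_mul2r ik orbT].
Qed.

Lemma emittedS c : emitted c.+1 =
  if occupied c then emitted c ++ sides_code (left_side c) (bucket c) else emitted c.
Proof.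
rewrite /emitted /occupied_cells iotaSr filter_rcons add0n; case: ifP => // _.
by rewrite map_rcons flatten_rcons.
Qed.

Lemma occupied_cellsS c : size (occupied_cells c.+1) = size (occupied_cells c) + occupied c.
Proof.
rewrite /occupied_cells iotaSr filter_rcons add0n; case: ifP => // _.
  by rewrite size_rcons addn1.
by rewrite addn0.
Qed.

(** Each of the [k * n] pairs is pushed into a single bucket; this pays for the
copying of all buckets together. *)
Lemma sum_size_bucket N : \sum_(0 <= c < N) size (bucket c) <= k * n.
Proof.
under eq_bigr => c _ do rewrite size_map size_filter.
elim: (k * n) => [|a IH]; first by rewrite big1.
under eq_bigr => c _ do rewrite iotaSr -cats1 count_cat.
rewrite big_split /= -addn1 leq_add //.
under eq_bigr => c _ do rewrite /= addn0 add0n.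
rewrite big_mkord; case: (ltnP (destination a) N) => [lt | ge].
  rewrite (bigD1 (Ordinal lt)) //= eqxx big1 // => i ne.
  by apply/eqP; rewrite eqb0; apply: contraNN ne => /eqP e; apply/eqP/val_inj.
by rewrite big1 // => i _; apply/eqP; rewrite eqb0 neq_ltn (leq_trans _ ge) ?orbT.
Qed.

Lemma size_left_side c : size (left_side c) <= s.
Proof. by rewrite size_filter (leq_trans (count_size _ _)) ?size_iota. Qed.

Lemma size_emitted c :
  size (emitted c) <= c * (2 + s) + \sum_(0 <= c' < c) size (bucket c').
Proof.
elim: c => [|c IH]; first by rewrite /emitted.
rewrite emittedS big_nat_recr //=; case: ifP => _; last by lia.
by rewrite size_cat /= size_cat; have := size_left_side c; lia.
Qed.

End Buckets.

(** * The three loops of the algorithm *)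

(** One round pushes vertex v (register 13) into the bucket of its cell for group
i (register 12); their pair number is in register 10. The inner loop runs u
(register 15) through the group and accumulates the signature in register 14. *)
Definition bucket_loop : cmd :=
  Seq (Blk [:: IOp OpDiv 12 10 1; IOp OpMod 13 10 1; IConst 14 0;
               IOp OpMul 15 12 3; IOp OpAdd 16 15 3])
 (Seq (While 15 16 (Blk
        [:: IOp OpMul 17 15 1; IOp OpAdd 17 17 13; IOp OpAdd 17 17 2; ILoad 18 17;
            IOp OpAdd 14 14 14; IOp OpAdd 14 14 18; IOp OpAdd 15 15 2]))
      (Blk [:: IOp OpMul 17 12 4; IOp OpAdd 17 17 14; IOp OpMul 17 17 7;
               IOp OpAdd 17 17 7; ILoad 18 17; IOp OpAdd 19 17 18;
               IOp OpAdd 19 19 2; IStore 19 13; IOp OpAdd 18 18 2;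
               IStore 17 18; IOp OpAdd 10 10 2])).

(** One round treats the cell c in register 10. Its biclique is written at the
end of the output (register 8) in any case: two words are left for the sizes,
the first loop writes the described vertices, the second one copies the bucket.
A candidate u is written before its arc is known, and the bit of the arc is then
added to the write position, so that a wrong candidate is overwritten. Only if
both sides are nonempty is the end of the output moved past the biclique and the
number of bicliques (register 9) increased. *)
Definition emit_loop : cmd :=
  Seq (Blk [:: IOp OpMul 12 10 7; IOp OpAdd 12 12 7; ILoad 13 12;
               IOp OpAdd 14 12 2; ILoad 15 14;
               IOp OpDiv 16 10 4; IOp OpMul 16 16 3; IOp OpAdd 17 16 3;
               IOp OpAdd 18 8 2; IOp OpAdd 18 18 2; IConst 19 0])
 (Seq (While 16 17 (Blk
        [:: IStore 18 16; IOp OpMul 20 16 1; IOp OpAdd 20 20 15;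
            IOp OpAdd 20 20 2; ILoad 20 20; IOp OpAdd 18 18 20;
            IOp OpAdd 19 19 20; IOp OpAdd 16 16 2]))
 (Seq (Blk [:: IOp OpAdd 26 18 13])
 (Seq (While 18 26 (Blk
        [:: ILoad 20 14; IStore 18 20; IOp OpAdd 18 18 2; IOp OpAdd 14 14 2]))
 (Seq (Blk [:: IStore 8 19; IOp OpAdd 20 8 2; IStore 20 13; IOp OpMul 20 19 13;
               IOp OpAdd 10 10 2])
      (IfLt 25 20 (Blk [:: IOp OpAdd 8 18 25; IOp OpAdd 9 9 2])))))).

(** For vertices of different groups i and j the comparison [v <= u] only depends
on the groups, so all edges between i and j point the same way. Exchanging u and
v changes the comparison and nothing else: exactly one direction is chosen. *)
Definition orient (s u v : nat) : bool := odd ((v <= u) + u %/ s + v %/ s).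

Definition directed (s : nat) (A : nat -> nat -> bool) (u v : nat) : bool :=
  A u v && orient s u v.

(** For u and v below n the bit [v <= u] is the quotient of u + n - v by n. *)
Definition orient_loop : cmd := Blk
  [:: IOp OpDiv 12 10 1; IOp OpMod 13 10 1; IOp OpAdd 14 12 1; IOp OpSub 14 14 13;
      IOp OpDiv 14 14 1; IOp OpDiv 15 12 3; IOp OpAdd 14 14 15; IOp OpDiv 16 13 3;
      IOp OpAdd 14 14 16; IConst 17 2; IOp OpMod 14 14 17; IOp OpAdd 18 10 2;
      ILoad 19 18; IOp OpMul 19 19 14; IStore 18 19; IOp OpAdd 10 10 2].

(** [stride] is the distance between two rows of the bucket table, which starts at
address [stride], behind the matrix; [out] is the address of the output, behind
the table. *)
Section Phases.
Variables (w n s k K stride out : nat) (D : nat -> nat -> bool).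
Hypotheses (n0 : 0 < n) (s0 : 0 < s) (k0 : 0 < k) (KE : K = 2 ^ s).
Hypotheses (ks : k * s <= 2 * n) (hST : 2 * n * n < stride) (knST : k * n + 1 < stride).
Hypotheses (hO : (k * K + 1) * stride <= out) (hW : 4 * out <= 2 ^ w).
Hypothesis (hout : k * K * (2 + s) + k * n + 1 <= out).

(** The registers that keep their values throughout the three loops. *)
Definition constants (r : nat -> nat) : Prop :=
  [/\ [/\ r 0 = out, r 1 = n, r 2 = 1 & r 3 = s]
    & [/\ r 4 = K, r 5 = k * n, r 6 = k * K, r 7 = stride & r 25 = 0]].

(** The last group may stick out beyond n, up to 2 n; there the memory still holds
zeros, which rightly read as absent arcs. *)
Definition matrix_stored (m : nat -> nat) : Prop :=
  forall u v, u < 2 * n -> v < n -> m (u * n + v + 1) = D u v.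

(** A row holds the length of its bucket and then the members; beyond these it is
zero, which is also the default value of [nth]. *)
Definition buckets_stored (f : nat -> seq nat) (m : nat -> nat) : Prop :=
  forall c, c < k * K -> m (c * stride + stride) = size (f c) /\
    forall j, j.+1 < stride -> m (c * stride + stride + j + 1) = nth 0 (f c) j.

Local Notation signature := (signature s D).
Local Notation destination := (destination n s K D).
Local Notation pushed := (pushed n s K D).
Local Notation bucket := (bucket n s k K D).
Local Notation left_side := (left_side n s k K D).
Local Notation emitted := (emitted n s k K D).
Local Notation occupied_cells := (occupied_cells n s k K D).

Lemma matrix_addr u v : u < 2 * n -> v < n -> u * n + v + 1 <= 2 * n * n.
Proof.
move=> u2 vn; have : u.+1 * n <= 2 * n * n by rewrite leq_mul2r u2 orbT.
by rewrite mulSn; lia.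
Qed.

Lemma cell_addr c : c < k * K -> c * stride + stride + stride <= out.
Proof.
move=> ck; apply: leq_trans hO.
have : c.+1 * stride <= k * K * stride by rewrite leq_mul2r ck orbT.
by rewrite mulSn mulnDl mul1n; lia.
Qed.

Lemma cell_inj c d x y : x < stride -> y < stride ->
  (c * stride + stride + x == d * stride + stride + y) = (c == d) && (x == y).
Proof.
move=> xS yS; apply/eqP/andP => [e | [/eqP -> /eqP ->] //].
have {}e : c * stride + x = d * stride + y by lia.
have S0 : 0 < stride by lia.
have := congr1 (divn^~ stride) e; rewrite /= !divnMDl // !divn_small // !addn0 => cd.
by rewrite cd eqxx; split=> //; apply/eqP; move: e; rewrite cd; lia.
Qed.

Lemma K_le : K <= k * K.
Proof. by case: k k0 => // k' _; rewrite mulSn leq_addr. Qed.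

Lemma two_strides_le : stride + stride <= out.
Proof.
apply: leq_trans hO.
have K0 : 0 < K by rewrite KE expn_gt0.
have : 0 < k * K by rewrite muln_gt0 k0.
by case: (k * K) => // x _; rewrite mulnDl mulSn; lia.
Qed.

Lemma geq_div u v : u < n -> v < n -> (u + n - v) %/ n = (v <= u).
Proof.
move=> un vn; case: leqP => le /=; last by rewrite divn_small //; lia.
rewrite addnC -addnBA // divnDl ?dvdnn // divnn n0 divn_small ?addn0 //.
by lia.
Qed.

Section Orient.
Variable A : nat -> nat -> bool.
Local Notation directed := (directed s A).

(** The matrix is rewritten in row-major order; [a] entries are done. Everything
behind the matrix is still zero, as the empty bucket table has to be. *)
Definition orient_inv (a : nat) (st : state) : Prop :=
  [/\ constants st.1, st.1 10 = a, st.1 24 = n * n,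
     (forall x, 2 * n * n < x -> st.2 x = 0) &
     forall u v, u < 2 * n -> v < n ->
       st.2 (u * n + v + 1) = if u * n + v < a then directed u v else A u v].

Lemma orient_step a st : a < n * n -> orient_inv a st -> wp w orient_loop 16 (orient_inv a.+1) st.
Proof.
case: st => r m an [/= C r10 r24 m0 Hm]; have [[r0 r1 r2 r3] [r4 r5 r6 r7 r25]] := C.
have STO := two_strides_le.
have n2n : 2 * n <= 2 * n * n by rewrite leq_pmulr.
have an2 : a < 2 * n * n by lia.
have un : a %/ n < n by rewrite ltn_divLR //; lia.
have vn : a %% n < n by rewrite ltn_mod; lia.
have aw : a < 2 ^ w by lia.
apply/wp_blk => //.
ins; first by [].
ins; first by [].
have aE := divn_eq a n.
set u := a %/ n in un aE *; set v := a %% n in vn aE *.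
clearbody u v.
have oE : orient s u v = odd ((v <= u) + u %/ s + v %/ s) by [].
have usu := leq_div u s; have vsv := leq_div v s.
set us := u %/ s in oE usu; set vs := v %/ s in oE vsv.
ins; first by lia.
ins; first by lia.
ins; first by lia.
rewrite geq_div //.
ins; first by lia.
rewrite -/us; ins; first by lia.
ins; first by lia.
rewrite -/vs; ins; first by lia.
ins; first by lia.
ins; first by lia.
ins; first by lia.
have ma : m (a + 1) = A u v by rewrite {1}aE Hm -?aE ?ltnn //; lia.
ins; rewrite modn2 -oE ma.
ins; first by case: (A _ _); case: (orient _ _ _); lia.
ins.
ins; first by lia.
split=> //=.
- by rewrite /upd /= addn1.
- by move=> x hx; rewrite /upd gtn_eqF ?m0 //; lia.
move=> x y x2 yn; rewrite /upd eqn_add2r ltnS.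
have [e|ne] := eqVneq (x * n + y) a; last by rewrite Hm // [x * n + y <= a]leq_eqVlt (negbTE ne).
have yx : (u == x) && (v == y).
  have := congr1 (divn^~ n) (etrans (esym aE) (esym e)).
  have := congr1 (modn^~ n) (etrans (esym aE) (esym e)).
  rewrite /= !modnMDl !divnMDl // !modn_small // !divn_small // !addn0.
  by move=> -> ->; rewrite !eqxx.
by case/andP: yx => /eqP <- /eqP <-; rewrite -aE leqnn mulnb.
Qed.

End Orient.

Definition bucket_inv (a : nat) (st : state) : Prop :=
  [/\ constants st.1, st.1 10 = a, matrix_stored st.2 & buckets_stored (pushed a) st.2].

Lemma bucket_step a st : a < k * n -> bucket_inv a st ->
  wp w bucket_loop (5 + (s * (7 + 2) + 2 + 11)) (bucket_inv a.+1) st.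
Proof.
case: st => r m akn [/= C r10 Hm Hl]; have [[r0 r1 r2 r3] [r4 r5 r6 r7 r25]] := C.
have STO := two_strides_le; have KkK := K_le.
have nn : 2 * n <= 2 * n * n by rewrite leq_pmulr.
have ik : a %/ n < k by rewrite ltn_divLR.
have vn : a %% n < n by rewrite ltn_mod.
have isn : (a %/ n) * s + s <= 2 * n.
  apply: leq_trans ks; rewrite addnC -mulSn leq_mul2r ik orbT //.
have dk : destination a < k * K by apply: destination_lt.
apply/wp_seq/wp_blk => //.
ins; first by lia.
ins; first by lia.
ins; first by lia.
ins; first by lia.
ins; first by lia.
set i := a %/ n in ik isn *; set v := a %% n in vn *.
apply/wp_seq.
pose J b (st : state) := [/\ st.2 = m, constants st.1, st.1 10 = a & [/\ st.1 12 = i, st.1 13 = v,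
  st.1 14 = bits_value (fun b => D (i * s + b) v) b, st.1 15 = i * s + b & st.1 16 = i * s + s]].
apply: (wp_while_const (I := J)) => [|b [r' m']|[r' m']].
- by rewrite /J /=; split=> //; split=> //; rewrite addn0.
- move=> bs [/= -> [[r'0 r'1 r'2 r'3] C2] r'10 [r'12 r'13 r'14 r'15 r'16]].
  split; first by rewrite r'15 r'16; lia.
  have adr : (i * s + b) * n + v + 1 <= 2 * n * n by apply: matrix_addr; lia.
  have cl : bits_value (fun b => D (i * s + b) v) b.+1 < 2 ^ s.
    by apply: leq_trans (bits_value_lt _ _) _; rewrite leq_exp2l.
  move: (cl); rewrite /= -KE => cl'.
  apply/wp_blk => //.
  ins; first by lia.
  ins; first by lia.
  ins; first by lia.
  ins; rewrite Hm //; last by lia.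
  ins; first by lia.
  ins; first by lia.
  ins; first by lia.
  split=> //; split=> //=; rewrite /upd /=; lia.
move=> [/= -> [[r'0 r'1 r'2 r'3] [r'4 r'5 r'6 r'7 r'25]] r'10 [r'12 r'13 r'14 r'15 r'16]].
split; first by rewrite r'15 r'16.
rewrite -/(signature i v) in r'14.
have dE : destination a = i * K + signature i v by [].
have ca := cell_addr dk.
have cnt := size_pushed n s K D a (destination a).
have [Hsz Hel] := Hl _ dk.
apply/wp_blk => //.
ins; first by lia.
ins; first by lia.
rewrite -dE.
ins; first by lia.
ins; first by lia.
ins; rewrite Hsz.
ins; first by lia.
ins; first by lia.
ins.
ins; first by lia.
ins.
ins; first by lia.
split=> //=.
- by rewrite /upd /=; lia.
- move=> u v' u2 v'n; have := matrix_addr u2 v'n => ma.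
  rewrite /upd; do 2 (case: eqP => [e|_]; first by lia).
  exact: Hm.
move=> c ck; have [Hsz' Hel'] := Hl _ ck.
have e0 x y d : x < stride -> y < stride ->
  (c * stride + stride + x == d * stride + stride + y) = (c == d) && (x == y) by apply: cell_inj.
have S0 : 0 < stride by lia.
rewrite pushedS /upd; split=> [|j jS].
  have := e0 0 0 (destination a) S0 S0; rewrite !addn0 => ->.
  have := e0 0 (size (pushed a (destination a)) + 1) (destination a) S0.
  rewrite addn0 !addnA => ->; last by lia.
  rewrite eq_sym; case: eqP => [-> |_] /=; last by [].
  by rewrite size_rcons addn1.
have := e0 (j + 1) 0 (destination a); rewrite addn0 !addnA => -> //; last by lia.
have := e0 (j + 1) (size (pushed a (destination a)) + 1) (destination a).
rewrite !addnA => ->; [|lia|lia].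
have -> : (j + 1 == 0) = false by lia.
rewrite andbF eqn_add2r (eq_sym c); case: eqP => [e|_] /=; last by rewrite Hel'.
rewrite nth_rcons -e; case: ltngtP => // lt.
- by rewrite Hel.
- by rewrite Hel // nth_default // ltnW.
Qed.

(** The state of the memory below the output while the bicliques are emitted. *)
Definition tables_stored (m : nat -> nat) : Prop := matrix_stored m /\ buckets_stored bucket m.

Lemma tables_stored_ext m m' :
  (forall a, a < out -> m' a = m a) -> tables_stored m -> tables_stored m'.
Proof.
move=> e [Hm Hl]; have STO := two_strides_le; split=> [u v u2 vn | c ck].
  by rewrite e ?Hm //; have := matrix_addr u2 vn; lia.
have [sz el] := Hl _ ck; have ca := cell_addr ck.
by split=> [|j jS]; rewrite e; [| lia | rewrite el | lia].
Qed.

(** Nothing is said about the memory behind the emitted words, where a rejected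
biclique may have left its traces. *)
Definition emit_inv (c : nat) (st : state) : Prop :=
  [/\ constants st.1, st.1 10 = c, tables_stored st.2 &
   [/\ st.1 8 = out + 1 + size (emitted c), st.1 9 = size (occupied_cells c) &
    forall j, j < size (emitted c) -> st.2 (out + 1 + j) = nth 0 (emitted c) j]].

Lemma emit_step c st : c < k * K -> emit_inv c st ->
  wp w emit_loop (11 + (s * (8 + 2) + 2 + (1 + (size (bucket c) * (4 + 2) + 2 +
    (5 + (2 + 2)))))) (emit_inv c.+1) st.
Proof.
case: st => r m ck [/= C r10 Hlow [r8 r9 Hout]].
have [[r0 r1 r2 r3] [r4 r5 r6 r7 r25]] := C.
have [Hm Hl] := Hlow.
have STO := two_strides_le; have KkK := K_le; have ca := cell_addr ck.
have nn : 2 * n <= 2 * n * n by rewrite leq_pmulr.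
have K0 : 0 < K by rewrite KE expn_gt0.
have ik : c %/ K < k by rewrite ltn_divLR.
have isn : (c %/ K) * s + s <= 2 * n.
  by apply: leq_trans ks; rewrite addnC -mulSn leq_mul2r ik orbT.
have [Hsz Hel] := Hl _ ck.
have cntk : size (bucket c) <= k * n by apply: size_pushed.
have szl : size (left_side c) <= s by apply: size_left_side.
have szO : size (emitted c) + 2 + s + size (bucket c) + 1 <= out.
  apply: leq_trans hout; have := size_emitted n s k K D c.
  have := sum_size_bucket n s k K D c.+1; rewrite big_nat_recr //=.
  have : c.+1 * (2 + s) <= k * K * (2 + s) by rewrite leq_mul2r ck orbT.
  by rewrite mulSn; lia.
(* The program tests both sides for emptiness by multiplying their sizes. *)
have prO : size (left_side c) * size (bucket c) <= out.
  apply: leq_trans hO; apply: leq_mul; last by lia.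
  have : s < K by rewrite KE ltn_expl.
  by lia.
set v0 := nth 0 (bucket c) 0.
have v0n : v0 < n.
  rewrite /v0; case: (ltnP 0 (size (bucket c))) => [lt|le]; last by rewrite nth_default.
  by have := mem_nth 0 lt; case/mapP => a _ ->; rewrite ltn_mod.
apply/wp_seq/wp_blk => //.
ins; first by lia.
ins; first by lia.
ins; rewrite Hsz.
ins; first by lia.
ins; have := Hel 0; rewrite addn0 -/v0 => ->; last by lia.
ins; first by lia.
ins; first by lia.
ins; first by lia.
ins; first by lia.
ins; first by lia.
ins; first by lia.
set p0 := out + 1 + size (emitted c) in r8 *; set i := c %/ K in ik isn *.
apply/wp_seq.
(* The described vertices among the first b of the group. *)
pose S b := [seq u <- iota (i * s) b | D u v0].
pose J b (st : state) := [/\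
  [/\ constants st.1, st.1 10 = c, st.1 8 = p0 & st.1 9 = size (occupied_cells c)],
  forall a, a < p0 + 2 -> st.2 a = m a,
  [/\ st.1 13 = size (bucket c), st.1 14 = c * stride + stride + 1, st.1 15 = v0,
     st.1 16 = i * s + b & st.1 17 = i * s + s],
  st.1 18 = p0 + 2 + size (S b) /\ st.1 19 = size (S b) &
  forall j, j < size (S b) -> st.2 (p0 + 2 + j) = nth 0 (S b) j].
apply: (wp_while_const (I := J)) => [|b [r' m']|[r' m']].
- rewrite /J /=; split=> //; split=> //; rewrite /upd /=; lia.
- move=> bs [/= [[[r'0 r'1 r'2 r'3] C2] r'10 r'8 r'9] Hm' [r'13 r'14 r'15 r'16 r'17]
    [r'18 r'19] HS].
  split; first by rewrite r'16 r'17; lia.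
  have szS : size (S b) <= b.
    by rewrite size_filter (leq_trans (count_size _ _)) ?size_iota.
  have adr : (i * s + b) * n + v0 + 1 <= 2 * n * n by apply: matrix_addr; lia.
  have SE : S b.+1 = if D (i * s + b) v0 then rcons (S b) (i * s + b) else S b.
    by rewrite /S iotaSr filter_rcons.
  have sSE : size (S b.+1) = size (S b) + D (i * s + b) v0.
    by rewrite SE; case: ifP; rewrite ?size_rcons ?addn1 ?addn0.
  apply/wp_blk => //.
  ins.
  ins; first by lia.
  ins; first by lia.
  ins; first by lia.
  ins; rewrite [upd m' _ _ _]/upd ltn_eqF; last by lia.
  rewrite Hm'; last by lia.
  rewrite Hm //; last by lia.
  ins; first by case: (D _ _); lia.
  ins; first by case: (D _ _); lia.
  ins; first by lia.
  split=> //=.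
  + move=> a ap; rewrite /upd ltn_eqF; last by lia.
    exact: Hm'.
  + by split=> //; rewrite /upd /=; lia.
  + by rewrite /upd /= sSE addnA.
  + move=> j; rewrite sSE => jl; rewrite /upd eqn_add2l SE.
    case: eqP jl => [-> | /eqP ne] jl.
      case: (D _ _) jl => [_|]; first by rewrite nth_rcons ltnn eqxx.
      by rewrite addn0 ltnn.
    have js : j < size (S b) by case: (D _ _) jl; lia.
    by rewrite HS //; case: ifP => _ //; rewrite nth_rcons js.
move=> [/= [[[r'0 r'1 r'2 r'3] C2] r'10 r'8 r'9] Hm' [r'13 r'14 r'15 r'16 r'17]].
have -> : S s = left_side c by [].
move=> [r'18 r'19] HS.
split; first by rewrite r'16 r'17.
apply/wp_seq/wp_blk => //.
ins; first by lia.
apply/wp_seq.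
pose J2 b (st : state) := [/\
  [/\ constants st.1, st.1 10 = c, st.1 8 = p0 & st.1 9 = size (occupied_cells c)],
  forall a, a < p0 + 2 -> st.2 a = m a,
  [/\ st.1 13 = size (bucket c), st.1 14 = c * stride + stride + b + 1,
     st.1 19 = size (left_side c), st.1 18 = p0 + 2 + size (left_side c) + b
   & st.1 26 = p0 + 2 + size (left_side c) + size (bucket c)]&
  forall j, j < size (left_side c) + b -> st.2 (p0 + 2 + j) = nth 0 (left_side c ++ bucket c) j].
apply: (wp_while_const (I := J2)) => [|b [r1' m1]|[r1' m1]].
- rewrite /J2 /=; split=> //; first by rewrite !addn0; split.
  by move=> j; rewrite addn0 => jl; rewrite HS // nth_cat jl.
- move=> bs [/= [[[q0 q1 q2 q3] C3] q10 q8 q9] Hm1 [q13 q14 q19 q18 q26] HS1].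
  split; first by rewrite q18 q26; lia.
  apply/wp_blk => //.
  ins; rewrite Hm1; last by lia.
  rewrite Hel; last by lia.
  ins.
  ins; first by lia.
  ins; first by lia.
  split=> //=.
  + move=> a ap; rewrite /upd ltn_eqF; last by lia.
    exact: Hm1.
  + by split=> //; rewrite /upd /=; lia.
  + move=> j jl; rewrite /upd -[_ + size (left_side c) + b]addnA eqn_add2l.
    case: eqP => [-> | ne]; first by rewrite nth_cat ltnNge leq_addr /= addKn.
    by rewrite HS1 //; lia.
move=> [/= [[[q0 q1 q2 q3] [q4 q5 q6 q7 q25]] q10 q8 q9] Hm1 [q13 q14 q19 q18 q26] HS1].
split; first by rewrite q18 q26.
apply/wp_seq/wp_blk => //.
ins.
ins; first by lia.
ins.
ins; first by lia.
ins; first by lia.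
have p0E : p0 = out + 1 + size (emitted c) by [].
set m2 := upd (upd m1 _ _) _ _.
have low2 : tables_stored m2.
  apply: tables_stored_ext Hlow => a aO; rewrite /m2 /upd ltn_eqF; last by lia.
  by rewrite ltn_eqF ?Hm1 //; lia.
have out2 j : j < size (emitted c) -> m2 (out + 1 + j) = nth 0 (emitted c) j.
  move=> jl; rewrite /m2 /upd ltn_eqF; last by lia.
  by rewrite ltn_eqF ?Hm1 ?Hout //; lia.
apply: wp_if => gd.
  have cc : size (occupied_cells c) <= c.
    by rewrite size_filter (leq_trans (count_size _ _)) ?size_iota.
  have cST : c <= c * stride by rewrite leq_pmulr //; lia.
  have {}gd : r1' 25 < size (left_side c) * size (bucket c) := gd; rewrite q25 in gd.
  apply/wp_blk => //.
  ins; first by lia.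
  ins; first by lia.
  have gc : occupied n s k K D c by [].
  split=> //=.
    by rewrite /upd /=; lia.
  rewrite emittedS occupied_cellsS gc size_cat /= size_cat; split; rewrite /upd /= -/m2.
  - by lia.
  - by [].
  move=> j jl; rewrite nth_cat; case: ltnP => [/out2 // | ge].
  have jd : j - size (emitted c) < (size (left_side c) + size (bucket c)).+2 by lia.
  rewrite -{1}(subnKC ge) addnA -/p0; case: (j - _) jd => [|[|d]] dl; rewrite /m2 /upd /=.
  - by rewrite addn0 ltn_eqF ?addn1 // eqxx.
  - by rewrite eqxx.
  - have -> : (p0 + d.+2 == p0 + 1) = false by lia.
    have -> : (p0 + d.+2 == p0) = false by lia.
    by rewrite (_ : p0 + d.+2 = p0 + 2 + d) ?HS1 //; lia.
have {}gd : size (left_side c) * size (bucket c) <= r1' 25 := gd; rewrite q25 in gd.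
have gc : occupied n s k K D c = false by apply/negbTE; rewrite -leqNgt.
split=> //=; first by rewrite /upd /=; lia.
by rewrite emittedS occupied_cellsS gc addn0; split.
Qed.

End Phases.

(** * The whole program and its running time *)

(** About lg n - 2 lg lg n. Each subtracted logarithm divides the number of
signatures by lg n, which makes [2 ^ group_size n] of order n / lg^2 n, while the
number of groups stays at n / lg n up to a factor 1 + O(lg lg n / lg n). The
summand 1 keeps the size positive. *)
Definition group_size (n : nat) : nat :=
  let l := trunc_log 2 n in l + 1 - (trunc_log 2 l + trunc_log 2 l).
Definition group_count (n : nat) : nat := n %/ group_size n + 1.

Lemma double_log_le l : trunc_log 2 l + trunc_log 2 l <= l.
Proof.
case: l => // l; apply: leq_trans (@trunc_logP 2 l.+1 _ _) => //.
elim: (trunc_log _ _) => [|[|x] IH] //; rewrite expnS; lia.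
Qed.

Lemma group_size_gt0 n : 0 < group_size n.
Proof. by rewrite /group_size; have := double_log_le (trunc_log 2 n); lia. Qed.

Lemma group_size_le n : 0 < n -> group_size n <= n.
Proof.
move=> n0; rewrite /group_size; have := trunc_logP (isT : 1 < 2) n0.
by have := ltn_expl (trunc_log 2 n) (isT : 1 < 2); lia.
Qed.

Lemma exp_group_size_le n : 0 < n -> 2 ^ group_size n <= 2 * n.
Proof.
move=> n0; have := trunc_logP (isT : 1 < 2) n0; rewrite -(leq_pmul2l (isT : 0 < 2)).
by apply: leq_trans; rewrite -expnS leq_exp2l // /group_size; lia.
Qed.

(** Adjacency of natural numbers, false outside of the vertex set; the program
also asks for the vertices of the last group beyond n. *)
Definition nadj n (G : sgraph 'I_n) (u v : nat) : bool :=
  if (insub u, insub v) is (Some i, Some j) then adj G i j else false.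

Lemma nadjE n (G : sgraph 'I_n) (u v : 'I_n) : nadj G u v = adj G u v.
Proof. by rewrite /nadj !valK. Qed.

Lemma nadj_lt n (G : sgraph 'I_n) u v : nadj G u v -> (u < n) && (v < n).
Proof. by rewrite /nadj; case: insubP => // i -> _; case: insubP => // j ->. Qed.

Lemma nth_allpairs (S T : Type) (f : S -> T -> nat) xs ys x0 y0 i j :
  i < size xs -> j < size ys ->
  nth 0 [seq f x y | x <- xs, y <- ys] (i * size ys + j) =
  f (nth x0 xs i) (nth y0 ys j).
Proof.
elim: xs i => //= x xs IH [|i] ix jy; rewrite nth_cat size_map.
  by rewrite mul0n add0n jy (nth_map y0).
by rewrite mulSn -addnA ltnNge leq_addr /= addKn IH.
Qed.

Lemma graph_code_matrix n (G : sgraph 'I_n) u v : v < n ->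
  nth 0 (graph_code G) (u * n + v + 1) = nadj G u v.
Proof.
move=> vn; rewrite addn1 /=; case: (ltnP u n) => [un | nu].
  have := @nth_allpairs _ _ (fun i j => nat_of_bool (adj G i j)) (enum 'I_n) (enum 'I_n)
     (Ordinal un) (Ordinal un) u v.
  rewrite size_enum_ord => -> //.
  rewrite (nth_ord_enum _ (Ordinal un)) (nth_ord_enum _ (Ordinal vn)).
  by rewrite -nadjE.
rewrite nth_default; last first.
  rewrite size_allpairs size_enum_ord; apply: leq_trans (leq_addr _ _).
  by rewrite leq_mul2r nu orbT.
by case: (nadj G u v) (@nadj_lt n G u v) => // /(_ isT); rewrite ltnNge nu.
Qed.

Lemma graph_code_out n (G : sgraph 'I_n) x : n * n < x -> nth 0 (graph_code G) x = 0.
Proof.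
by move=> lt; rewrite nth_default //= size_allpairs size_enum_ord.
Qed.

(** Puts the integer logarithm of register 20 into register 21: register 22 runs
through the powers of 2 until it exceeds register 20. *)
Definition log_loop : cmd :=
  Seq (Blk [:: IConst 21 0; IConst 22 2; IOp OpAdd 23 20 2])
      (While 22 23 (Blk [:: IOp OpAdd 22 22 22; IOp OpAdd 21 21 2])).

(** The bucket table gets the stride n^4 and the output the address n^9. *)
Definition parameters : cmd :=
  Seq (Blk [:: IConst 2 1; ILoad 1 25; IOp OpMul 24 1 1; IOp OpMul 7 24 24;
               IOp OpMul 0 7 7; IOp OpMul 0 0 1; IOp OpAdd 20 1 25])
 (Seq log_loop
 (Seq (Blk [:: IOp OpAdd 13 21 25; IOp OpAdd 20 21 25])
 (Seq log_loop
      (Blk [:: IOp OpAdd 14 21 21; IOp OpAdd 3 13 2; IOp OpSub 3 3 14;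
               IOp OpShl 4 2 3; IOp OpDiv 15 1 3; IOp OpAdd 15 15 2;
               IOp OpMul 5 15 1; IOp OpMul 6 15 4; IConst 10 0])))).

Definition main_command : cmd :=
  Seq parameters
 (Seq (While 10 24 orient_loop)
 (Seq (Blk [:: IConst 10 0])
 (Seq (While 10 5 bucket_loop)
 (Seq (Blk [:: IConst 9 0; IOp OpAdd 8 0 2; IConst 10 0])
 (Seq (While 10 6 emit_loop)
      (Blk [:: IStore 0 9])))))).

Definition main_program : program := compile 0 main_command ++ [:: IHalt].

Lemma log_loop_spec w x r m (Q : state -> Prop) :
  r 20 = x -> r 2 = 1 -> 0 < x -> 2 * x + 2 < 2 ^ w ->
  (forall r', (forall i, i \notin [:: 21; 22; 23] -> r' i = r i) ->
     r' 21 = trunc_log 2 x -> Q (r', m)) ->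
  wp w log_loop (3 + (trunc_log 2 x * (2 + 2) + 2)) Q (r, m).
Proof.
move=> r20 r2 x0 xw HQ; set l := trunc_log 2 x.
have le : 2 ^ l <= x by apply: trunc_logP.
have gt : x < 2 ^ l.+1 by apply: trunc_log_ltn.
apply/wp_seq/wp_blk => //.
ins; first by lia.
ins; first by lia.
ins; first by lia.
pose J b (st : state) := [/\ forall i, i \notin [:: 21; 22; 23] -> st.1 i = r i,
  st.2 = m, st.1 23 = x + 1, st.1 22 = 2 ^ b.+1 & st.1 21 = b].
apply: (wp_while_const (I := J)) => [|b [r' m']|[r' m']].
- by split=> //= i; rewrite !inE !negb_or /upd => /and3P[/negbTE -> /negbTE -> /negbTE ->].
- move=> bl [/= Hr' -> r'23 r'22 r'21].
  have bx : 2 ^ b.+1 <= x by apply: leq_trans le; rewrite leq_exp2l.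
  have r'2 : r' 2 = 1 by rewrite Hr'.
  split; first by rewrite r'22 r'23 addn1 ltnS.
  apply/wp_blk => //.
  ins; first by lia.
  ins; first by have := ltn_expl b.+1 (isT : 1 < 2); lia.
  split=> //=; last by rewrite /upd /= addn1.
    by move=> i hi; rewrite -Hr' //; move: hi; rewrite !inE !negb_or /upd =>
      /and3P[/negbTE -> /negbTE -> _].
  by rewrite /upd /= [in RHS]expnS; lia.
move=> [/= Hr' -> r'23 r'22 r'21]; rewrite r'22 r'23 addn1; split=> //.
exact: HQ.
Qed.

Section Run.
Variables (n w : nat) (G : sgraph 'I_n).
Hypotheses (n2 : 1 < n) (nw : n ^ 11 <= 2 ^ w).

Local Notation s := (group_size n).
Local Notation k := (group_count n).
Local Notation K := (2 ^ group_size n).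
(* Powers of n, bracketed in the way in which the program multiplies. *)
Local Notation stride := (n * n * (n * n)).
Local Notation out := (stride * stride * n).
Local Notation A := (nadj G).
Local Notation directed := (directed s A).

Lemma group_count_le : k <= n + 1.
Proof. by rewrite /group_count leq_add2r leq_div. Qed.

Lemma groups_le : k * s <= 2 * n.
Proof.
rewrite /group_count mulnDl mul1n; have := leq_divM n s.
by have := group_size_le (ltnW n2); lia.
Qed.

(** Four times the address of the output fits into a word, which leaves room for
the output and for all intermediate results. *)
Lemma squares_le : [/\ 2 * n <= n * n, 2 * (n * n) < stride & 4 * out <= 2 ^ w].
Proof.
have nn : 2 * n <= n * n by rewrite leq_mul2r n2 orbT.
have -> : 4 * out = 4 * n ^ 9 by rewrite !expnS expn0; lia.
split=> //; first by nia.
apply: leq_trans nw; rewrite (_ : 11 = 2 + 9) // expnD leq_mul2r; apply/orP; right.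
by rewrite (leq_exp2r 2 n (isT : 0 < 2)) n2.
Qed.

Lemma table_le : k * K <= 3 * (n * n).
Proof.
apply: leq_trans (leq_mul group_count_le (exp_group_size_le (ltnW n2))) _.
by nia.
Qed.

Lemma pushes_le : k * n + 1 < stride.
Proof.
have := leq_mul group_count_le (leqnn n); have [] := squares_le; nia.
Qed.

Lemma table_room : (k * K + 1) * stride <= out.
Proof.
rewrite [X in X <= _]mulnC -[X in _ <= X]mulnA leq_mul2l; apply/orP; right.
by have := table_le; have [] := squares_le; nia.
Qed.

Lemma output_room : k * K * (2 + s) + k * n + 1 <= out.
Proof.
have pu := pushes_le; have [h1 h2 h3] := squares_le.
have h : 2 + s <= 2 * n by have := group_size_le (ltnW n2); lia.
have c3 : n * n * n <= stride by rewrite leq_mul2l leq_pmulr ?orbT //; lia.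
have ST8 : 8 <= stride * n by nia.
have := leq_mul table_le h; have := leq_mul (leqnn stride) ST8; lia.
Qed.

Lemma parameters_spec (Q : state -> Prop) m : m 0 = n ->
  (forall r, constants n s k K stride out r -> r 10 = 0 -> r 24 = n * n -> Q (r, m)) ->
  wp w parameters (30 + 8 * n) Q (fun=> 0, m).
Proof.
move=> mn HQ; have [h1 h2 h3] := squares_le.
have hn : n * n <= stride by lia.
have hSS : stride <= stride * stride by rewrite leq_pmulr // !muln_gt0; lia.
have hO : stride * stride <= out by rewrite leq_pmulr //; lia.
set l := trunc_log 2 n; have ll := ltn_expl l (isT : 1 < 2).
have ln : 2 ^ l <= n by apply: trunc_logP => //; lia.
have l0 : 0 < l by rewrite trunc_log_gt0 n2.
have lll := double_log_le l.
apply: (@wp_weaken _ _ _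
  (7 + (3 + (l * 4 + 2) + (2 + (3 + (trunc_log 2 l * 4 + 2) + 9)))) _ Q) => //.
  by lia.
apply/wp_seq/wp_blk => //.
ins; first by lia.
ins; rewrite mn.
ins; first by lia.
ins; first by lia.
ins; first by lia.
ins; first by lia.
ins; first by lia.
apply/wp_seq/log_loop_spec; [by rewrite /upd /= addn0 | by [] | by lia | by lia | ].
move=> r Hr r21.
have [r0 r1 r2 r7 r25] : [/\ r 0 = out, r 1 = n, r 2 = 1, r 7 = stride & r 25 = 0].
  by split; rewrite Hr.
have r24 : r 24 = n * n by rewrite Hr.
apply/wp_seq/wp_blk => //.
ins; first by lia.
ins; first by lia.
apply/wp_seq/log_loop_spec; [by rewrite /upd /= addn0 | by [] | by lia | by lia | ].
move=> r' Hr' r'21.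
have [r'0 r'1 r'2 r'7 r'25] : [/\ r' 0 = out, r' 1 = n, r' 2 = 1, r' 7 = stride & r' 25 = 0].
  by split; rewrite Hr'.
have [r'24 r'13] : r' 24 = n * n /\ r' 13 = l by split; rewrite Hr' //; rewrite /upd /= addn0.
have Kle := exp_group_size_le (ltnW n2).
have cle := group_count_le; have ple := pushes_le; have tle := table_le.
apply/wp_blk => //.
ins; first by lia.
ins; first by lia.
ins; first by lia.
rewrite -/(group_size n).
ins; first by lia.
rewrite mul1n.
ins; first by lia.
ins; first by move: cle; rewrite /group_count; lia.
rewrite -/(group_count n).
ins; first by lia.
ins; first by lia.
ins; first by lia.
exact: HQ.
Qed.

Definition program_output : seq nat :=
  size (occupied_cells n s k K directed (k * K)) :: emitted n s k K directed (k * K).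

(** The sum of the costs that the rules yield for the successive commands of
[main_command], kept in the form in which they yield it. *)
Definition run_time : nat :=
  30 + 8 * n + (n * n * (16 + 2) + 2 + (1 +
   (k * n * (5 + (s * (7 + 2) + 2 + 11) + 2) + 2 + (3 +
   (\sum_(0 <= c < k * K) (11 + (s * (8 + 2) + 2 +
      (1 + (size (bucket n s k K directed c) * (4 + 2) + 2 + (5 + (2 + 2))))) + 2) + 2
    + 1))))).

Lemma run_time_le : run_time <= 300 * n ^ 2.
Proof.
have kn := group_count_le; have ksn := groups_le.
have Kn := exp_group_size_le (ltnW n2).
have h1 : k * n * s <= 2 * (n * n) by nia.
have h2 : k * n <= 2 * (n * n) by nia.
have h3 : k * K * s <= 4 * (n * n).
  by rewrite mulnAC; apply: leq_trans (leq_mul ksn Kn) _; lia.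
have h4 := table_le.
rewrite /run_time; set S := \sum_(0 <= c < _) _.
have : S <= k * K * 27 + k * K * s * 10 + 6 * (k * n).
  rewrite /S (eq_bigr (fun c => 6 * size (bucket n s k K directed c) + (27 + s * 10)))
    => [|c _]; last by lia.
  rewrite big_split /= sum_nat_const_nat subn0 -big_distrr /=.
  by have := sum_size_bucket n s k K directed (k * K); lia.
have h5 : 2 * n <= n * n by rewrite leq_mul2r n2 orbT.
by move: S => S hS; rewrite expnS expn1; lia.
Qed.

Lemma input_word i : nth 0 (graph_code G) i < 2 ^ w.
Proof.
have nw' : n < 2 ^ w by apply: leq_trans nw; rewrite -{1}(expn1 n) ltn_exp2l.
case: (ltnP i (size (graph_code G))) => [lt | ?]; last by rewrite nth_default //; lia.
have := mem_nth 0 lt; rewrite inE => /orP[/eqP -> // | /allpairsP[p [_ _ ->]]].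
by case: (adj _ _ _); lia.
Qed.

Definition answers (a : nat) (st : state) : Prop :=
  st.1 0 = a /\ forall i, i < size program_output -> st.2 (a + i) = nth 0 program_output i.

Lemma main_spec :
  wp w main_command run_time (answers out)
    (fun=> 0, fun a => trunc w (nth 0 (graph_code G) a)).
Proof.
have inm a : trunc w (nth 0 (graph_code G) a) = nth 0 (graph_code G) a.
  by rewrite /trunc modn_small ?input_word.
have n0 := ltnW n2; have s0 := group_size_gt0 n.
have k0 : 0 < k by rewrite /group_count addn1.
have [h1 h2 h3] := squares_le.
have ks := groups_le; have kST := pushes_le; have tO := table_room; have oO := output_room.
have hST : 2 * n * n < stride by rewrite -mulnA.
have STO := two_strides_le n0 s0 k0 erefl ks hST kST tO h3 oO.
apply/wp_seq/parameters_spec => [|r C r10 r24]; first exact: inm.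
(* From here on only the inequalities between the addresses matter. *)
move: stride out C kST tO oO hST STO h2 h3 => stride0 out0 C kST tO oO hST STO h2 h3.
have ca := cell_addr n0 s0 k0 erefl ks hST kST tO h3 oO.
apply/wp_seq.
apply: (wp_while_const (I := orient_inv n s k K stride0 out0 (nadj G))) => [|a st an Ia|st].
- split=> //= [x hx | u v u2 vn]; rewrite inm; last by rewrite graph_code_matrix.
  by rewrite graph_code_out //; lia.
- split; last by apply: (orient_step n0 s0 k0 erefl ks hST kST tO h3 oO).
  by case: Ia => [_ -> -> _ _].
case: st => r' m' [/= C' r'10 r'24 m'0 Hm']; split; first by rewrite r'10 r'24.
have {}Hm' : matrix_stored n directed m'.
  move=> u v u2 vn; rewrite Hm' //; case: ltnP => // ge.
  rewrite /directed; case uv: (A u v) => //=.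
  have /andP[un _] := nadj_lt uv; have : u.+1 * n <= n * n by rewrite leq_mul2r un orbT.
  by rewrite mulSn; lia.
have [[c0 c1 c2 c3] [c4 c5 c6 c7 c25]] := C'.
apply/wp_seq/wp_blk => //.
ins; first by lia.
apply/wp_seq.
apply: (wp_while_const (I := bucket_inv n s k K stride0 out0 directed)) => [|a st an Ia|st].
- split=> //= c ck; have ca' := ca _ ck.
  by split=> [|j jS]; rewrite m'0 ?nth_nil //; lia.
- split; last by apply: (bucket_step n0 s0 k0 erefl ks hST kST tO h3 oO).
  by case: Ia => [[[_ _ _ _] [_ -> _ _ _]] -> _ _].
case: st {C' c0 c1 c2 c3 c4 c5 c6 c7 c25 r'10 r'24 m'0 Hm'} =>
  [r1 m1] [/= C1 r10' Hm1 Hl1].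
have [[c0 c1 c2 c3] [c4 c5 c6 c7 c25]] := C1.
split; first by rewrite r10' c5.
apply/wp_seq/wp_blk => //.
ins; first by lia.
ins; first by lia.
ins; first by lia.
apply/wp_seq.
apply: (wp_while (I := emit_inv n s k K stride0 out0 directed)) => [|c st ck Ic|st].
- split=> //=; split=> //=; first by rewrite /upd /= addn0.
- split; last by apply: (emit_step n0 s0 k0 erefl ks hST kST tO h3 oO).
  by case: Ic => [[[_ _ _ _] [_ _ -> _ _]] -> _ _].
case: st {c0 c1 c2 c3 c4 c5 c6 c7 c25 C1 r10' Hm1 Hl1} =>
  [r2 m2] [/= C2 r10' _ [r8 r9 Hout]].
have [[c0 c1 c2 c3] [c4 c5 c6 c7 c25]] := C2.
split; first by rewrite r10' c6.
apply/wp_blk => //.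
ins.
split=> //= i; rewrite /program_output /= ltnS => iO; rewrite /upd -{2}[out0]addn0 eqn_add2l.
case: i iO => [|i] iO //=.
by rewrite (_ : out0 + i.+1 = out0 + 1 + i) ?Hout //; lia.
Qed.

Lemma output_fits : out + size program_output <= 2 ^ w.
Proof.
have [_ _ h] := squares_le; have := output_room.
have := size_emitted n s k K directed (k * K); have := sum_size_bucket n s k K directed (k * K).
by rewrite /program_output /=; lia.
Qed.

Lemma main_program_runs :
  exists2 t, t <= 300 * n ^ 2 & runs_to w main_program (graph_code G) t program_output.
Proof.
have [t [st [tT rt [st0 stO]]]] := main_spec; exists t.
  exact: leq_trans tT run_time_le.
rewrite /runs_to /init; have := rt [::] [:: IHalt]; rewrite /= => ->; split.
  by rewrite /halted add0n fetch_at.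
by split=> [|i iO] /=; rewrite st0 ?output_fits ?stO.
Qed.

End Run.

(** * The occupied cells form a biclique partition *)

(** The number of groups i that may send arcs to group j. Two consecutive numbers
different from j lie on the same side of j and have different parities, so one
of them qualifies; only the pair that contains j can contribute 2. *)
Lemma count_toward (j m : nat) :
  (count (fun i : nat => (i == j) || odd ((j < i) + i + j)) (iota 0 m)).*2 <= m + 3.
Proof.
set p := fun i : nat => _.
have even q : count p (iota 0 q.*2) <= q + (j < q.*2).
  elim: q => // q IH; rewrite doubleS !iotaSr -!cats1 !count_cat /= !addn0 !add0n.
  suff : p q.*2 + p q.*2.+1 + (j < q.*2) <= 1 + (j < q.*2.+2) by lia.
  have pE i : p i = (i == j) || (odd i (+) odd j (+) (j < i)).
    by rewrite /p !oddD oddb addbC addbA addbAC [odd j (+) _]addbC.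
  by rewrite !pE /= odd_double; case: (odd j); rewrite /= ?addbF ?addbT; lia.
have [h [b ->]] : exists h (b : bool), m = b + h.*2.
  by exists m./2, (odd m); rewrite odd_double_half.
have := even h; case: b; last by rewrite add0n; lia.
rewrite (_ : true + h.*2 = h.*2.+1) // iotaSr -cats1 count_cat /= addn0 add0n.
by have := leq_b1 (p h.*2); lia.
Qed.

Section Partition.
Variables (n : nat) (G : sgraph 'I_n).

Local Notation s := (group_size n).
Local Notation k := (group_count n).
Local Notation K := (2 ^ group_size n).
Local Notation D := (directed s (nadj G)).
Local Notation signature := (signature s D).
Local Notation bucket := (bucket n s k K D).
Local Notation left_side := (left_side n s k K D).
Local Notation occupied := (occupied n s k K D).
Local Notation occupied_cells := (occupied_cells n s k K D (k * K)).

Lemma adjC (u v : 'I_n) : adj G u v = adj G v u.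
Proof. by rewrite /adj setUC. Qed.

Lemma adj_neq (u v : 'I_n) : adj G u v -> u != v.
Proof.
by move=> uv; have := subsetP (valP G) _ uv; rewrite inE cards2; case: (u == v).
Qed.

Lemma directed_lt u v : D u v -> (u < n) && (v < n).
Proof. by case/andP => /nadj_lt. Qed.

Lemma directed_adj (u v : 'I_n) : D u v -> adj G u v.
Proof. by case/andP; rewrite nadjE. Qed.

Lemma orientC u v : u != v -> orient s v u = ~~ orient s u v.
Proof. by rewrite /orient; move: (u %/ s) (v %/ s) => i j; lia. Qed.

Lemma adj_directed (u v : 'I_n) : adj G u v -> D u v || D v u.
Proof.
move=> uv; rewrite /directed !nadjE [adj G v u]adjC uv /= (@orientC u v) ?orbN //.
exact: adj_neq.
Qed.

Lemma directed_asym (u v : 'I_n) : D u v -> ~~ D v u.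
Proof.
move=> uv; have := adj_neq (directed_adj uv) => ne.
by rewrite /directed orientC // negb_and negbK; case/andP: uv => _ ->; rewrite orbT.
Qed.

Lemma K_gt0 : 0 < K. Proof. by rewrite expn_gt0. Qed.

Lemma signature_lt i v : signature i v < K. Proof. exact: bits_value_lt. Qed.

Lemma mem_bucket c v : c < k * K ->
  (v \in bucket c) = (v < n) && (signature (c %/ K) v == c %% K).
Proof.
move=> ck; have K0 := K_gt0; apply/mapP/andP => [[a] | [vn /eqP sE]].
  rewrite mem_filter mem_iota add0n => /andP[/eqP <- akn] ->.
  have n0 : 0 < n by case: (n) akn => //; rewrite muln0.
  rewrite ltn_mod n0; split=> //; rewrite /destination divnMDl // modnMDl.
  by rewrite (divn_small (signature_lt _ _)) addn0 (modn_small (signature_lt _ _)).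
exists (c %/ K * n + v); last by rewrite modnMDl modn_small.
have n0 : 0 < n by lia.
rewrite mem_filter mem_iota add0n /destination divnMDl // modnMDl (divn_small vn) (modn_small vn).
rewrite addn0 sE -divn_eq eqxx /=; have : c %/ K < k by rewrite ltn_divLR.
by move=> ik; have : (c %/ K).+1 * n <= k * n by [rewrite leq_mul2r ik orbT]; rewrite mulSn; lia.
Qed.

Lemma bucket_uniq c : uniq (bucket c).
Proof.
rewrite map_inj_in_uniq ?filter_uniq ?iota_uniq // => a b.
rewrite !mem_filter => /andP[/eqP da _] /andP[/eqP db _] e.
have K0 := K_gt0.
have := congr1 (divn^~ K) (etrans da (esym db)).
rewrite /= !divnMDl // !(divn_small (signature_lt _ _)) !addn0 => de.
by rewrite (divn_eq a n) (divn_eq b n) e de.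
Qed.

Lemma mem_group i u : (u \in iota (i * s) s) = (u %/ s == i).
Proof.
have s0 := group_size_gt0 n; rewrite mem_iota addnC -mulSn.
by rewrite -leq_divRL // -ltn_divLR // eqn_leq ltnS andbC.
Qed.

(** This is why a bucket has a common left side. *)
Lemma signature_inj i v w : signature i v = signature i w -> forall u, u %/ s = i -> D u v = D u w.
Proof.
move=> e u ui; have := bits_value_inj e (ltn_pmod u (group_size_gt0 n)).
by rewrite /= -ui -divn_eq.
Qed.

Lemma mem_left_side c u v : c < k * K -> v \in bucket c ->
  (u \in left_side c) = (u %/ s == c %/ K) && D u v.
Proof.
move=> ck vb; rewrite mem_filter mem_group andbC; case: eqP => //= uc.
have := vb; rewrite mem_bucket // => /andP[_ /eqP sv].
have : nth 0 (bucket c) 0 \in bucket c by rewrite mem_nth //; case: (bucket c) vb.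
rewrite mem_bucket // => /andP[_ /eqP sh].
by apply: signature_inj uc; rewrite sv sh.
Qed.

(** The only cell that can contain an arc from [u] to [v]. *)
Definition cell_of (u v : nat) : nat := (u %/ s) * K + signature (u %/ s) v.

Lemma cell_lt u v : u < n -> cell_of u v < k * K.
Proof.
move=> un; have := signature_lt (u %/ s) v; rewrite /cell_of; move: (signature _ _) => x xK.
have uk : (u %/ s).+1 <= k by rewrite /group_count addn1 ltnS leq_div2r // ltnW.
by have : (u %/ s).+1 * K <= k * K by [rewrite leq_mul2r uk orbT]; rewrite mulSn; lia.
Qed.

Lemma cell_div u v : cell_of u v %/ K = u %/ s.
Proof. by rewrite /cell_of divnMDl ?K_gt0 // (divn_small (signature_lt _ _)) addn0. Qed.

Lemma cell_mod u v : cell_of u v %% K = signature (u %/ s) v.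
Proof. by rewrite /cell_of modnMDl (modn_small (signature_lt _ _)). Qed.

Lemma directed_cell u v : D u v ->
  [/\ cell_of u v < k * K, u \in left_side (cell_of u v) & v \in bucket (cell_of u v)].
Proof.
move=> uv; have /andP[un vn] := directed_lt uv; have ck := cell_lt v un.
have vb : v \in bucket (cell_of u v) by rewrite mem_bucket // vn cell_div cell_mod eqxx.
by split=> //; rewrite (mem_left_side _ ck vb) cell_div eqxx.
Qed.

Lemma cell_directed c u v : c < k * K -> u \in left_side c -> v \in bucket c ->
  D u v /\ c = cell_of u v.
Proof.
move=> ck ul vb; move: ul; rewrite (mem_left_side _ ck vb) => /andP[/eqP ue ->]; split=> //.
move: vb; rewrite mem_bucket // /cell_of ue => /andP[_ /eqP ->].
exact: divn_eq.
Qed.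

Lemma occupiedP c : reflect (exists u v, u \in left_side c /\ v \in bucket c) (occupied c).
Proof.
rewrite /occupied muln_gt0 -!has_predT; apply: (iffP andP).
  by case=> /hasP[u ul _] /hasP[v vb _]; exists u, v.
by case=> u [v [ul vb]]; split; apply/hasP; [exists u | exists v].
Qed.

(** The program lists vertices as numbers; here they are vertices again. *)
Definition ords (l : seq nat) : seq 'I_n := pmap insub l.

Lemma mem_ords l (i : 'I_n) : (i \in ords l) = (val i \in l).
Proof. by rewrite /ords mem_pmap_sub. Qed.

Lemma val_ords l : all (gtn n) l -> map val (ords l) = l.
Proof.
move=> ln; rewrite /ords (pmap_filter (insubK _)); apply/all_filterP.
by apply: sub_all ln => x; rewrite isSome_insub.
Qed.

Definition biclique_lists : seq (seq 'I_n * seq 'I_n) :=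
  [seq (ords (left_side c), ords (bucket c)) | c <- occupied_cells].

Definition biclique (c : nat) : bipair 'I_n :=
  ([set x in ords (left_side c)], [set x in ords (bucket c)]).

Definition signature_partition : {set bipair 'I_n} :=
  [set b in [seq biclique c | c <- occupied_cells]].

Lemma bucket_bound c v : v \in bucket c -> v < n.
Proof.
case/mapP => a; rewrite mem_filter mem_iota add0n => /andP[_ akn] ->.
by rewrite ltn_mod; case: (n) akn => //; rewrite muln0.
Qed.

Lemma mem_occupied_cells c : (c \in occupied_cells) = (c < k * K) && occupied c.
Proof. by rewrite mem_filter mem_iota add0n andbC. Qed.

Lemma mem_bedges c e : c < k * K -> e \in bedges (biclique c) ->
  exists u v : 'I_n, [/\ e = [set u; v], D u v & c = cell_of u v].
Proof.
move=> ck /imset2P[u v]; rewrite !inE !mem_ords => ul vb ->.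
by exists u, v; have [] := cell_directed ck ul vb.
Qed.

Lemma directed_bedges (u v : 'I_n) : D u v -> [set u; v] \in bedges (biclique (cell_of u v)).
Proof.
case/directed_cell => _ ul vb; apply/imset2P; exists u v => //.
  by rewrite inE mem_ords.
by rewrite inE mem_ords.
Qed.

(** As arcs are antisymmetric, an edge comes from a single arc. *)
Lemma set2_cell (u v x y : 'I_n) : D u v -> D x y -> [set u; v] = [set x; y] ->
  cell_of u v = cell_of x y.
Proof.
move=> uv xy e; have ne := adj_neq (directed_adj uv).
have := set21 u v; have := set22 u v; rewrite e !inE.
case/orP => /eqP vE /orP[] /eqP uE; rewrite ?uE ?vE //.
- by rewrite uE vE eqxx in ne.
- by have := directed_asym uv; rewrite uE vE xy.
- by rewrite uE vE eqxx in ne.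
Qed.

Lemma bedges_inj c c' e : c < k * K -> c' < k * K ->
  e \in bedges (biclique c) -> e \in bedges (biclique c') -> c = c'.
Proof.
move=> ck ck' /(mem_bedges ck)[u [v [eE uv ->]]] /(mem_bedges ck')[x [y [eE' xy ->]]].
by apply: set2_cell => //; rewrite -eE.
Qed.

Lemma occupied_edge c : c < k * K -> occupied c ->
  exists u v : 'I_n, [/\ D u v, u \in (biclique c).1 & v \in (biclique c).2].
Proof.
move=> ck /occupiedP[u [v [ul vb]]]; have [uv cE] := cell_directed ck ul vb.
have /andP[un vn] := directed_lt uv.
by exists (Ordinal un), (Ordinal vn); rewrite !inE !mem_ords.
Qed.

Lemma signature_partitionP : is_biclique_partition G signature_partition.
Proof.
apply/and3P; split.
- apply/forall_inP => b; rewrite inE => /mapP[c]; rewrite mem_occupied_cells => /andP[ck gc] ->.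
  have [u [v [uv ul vb]]] := occupied_edge ck gc.
  apply/and4P; split; [by apply/set0Pn; exists u | by apply/set0Pn; exists v | | ].
    rewrite -setI_eq0; apply/eqP/setP => x; rewrite !inE !mem_ords; apply/negP => /andP[xl xb].
    have [xx _] := cell_directed ck xl xb.
    by have := directed_asym xx; rewrite xx.
  apply/subsetP => e /(mem_bedges ck)[x [y [-> xy _]]]; exact: directed_adj.
- apply/forall_inP => b; rewrite inE => /mapP[c]; rewrite mem_occupied_cells => /andP[ck gc] ->.
  apply/forall_inP => b'; rewrite inE => /mapP[c']; rewrite mem_occupied_cells => /andP[ck' gc'] ->.
  apply/implyP => ne; rewrite -setI_eq0; apply/eqP/setP => e; rewrite inE [RHS]inE.
  apply/negP => /andP[ec ec']; move: ne.
  by rewrite (bedges_inj ck ck' ec ec') eqxx.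
- apply/eqP/setP => e; apply/bigcupP/idP => [[b] | eG].
    rewrite inE => /mapP[c]; rewrite mem_occupied_cells => /andP[ck gc] -> /(mem_bedges ck).
    by case=> u [v [-> uv _]]; apply: directed_adj.
  have := subsetP (valP G) e eG; rewrite inE => /cards2P[u [v [uv eE]]].
  rewrite eE in eG *; wlog duv : u v uv eE eG / D u v.
    move=> H; have /orP[d | d] := adj_directed eG; first exact: H d.
    by rewrite setUC; apply: H d; rewrite 1?eq_sym 1?[[set v; u]]setUC.
  exists (biclique (cell_of u v)); last exact: directed_bedges.
  have [ck ul vb] := directed_cell duv.
  by rewrite inE map_f // mem_occupied_cells ck; apply/occupiedP; exists (val u), (val v).
Qed.

Lemma card_signature_partition : #|signature_partition| <= k * K.
Proof.
rewrite cardsE; apply: leq_trans (card_size _) _; rewrite size_map size_filter.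
by apply: leq_trans (count_size _ _) _; rewrite size_iota.
Qed.

(** A vertex lies in a single group, hence in left sides of at most [K] cells. *)
Lemma left_load v : count (fun c => v \in left_side c) (iota 0 (k * K)) <= K.
Proof.
rewrite -size_filter -(size_map (modn^~ K)) -{4}(size_iota 0 K).
have K0 := K_gt0; apply: uniq_leq_size => [|x].
  rewrite map_inj_in_uniq ?filter_uniq ?iota_uniq // => c d.
  rewrite !mem_filter !mem_group => /andP[/andP[_ /eqP e] _] /andP[/andP[_ /eqP e'] _] m.
  by rewrite (divn_eq c K) (divn_eq d K) -e -e' m.
by case/mapP => c _ ->; rewrite mem_iota add0n ltn_mod.
Qed.

(** A vertex is in one bucket for each group, and the cell of that bucket is
occupied only if the group sends an arc to the vertex. *)
Lemma right_load v : count (fun c => occupied c && (v \in bucket c)) (iota 0 (k * K)) <= k %/ 2 + 2.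
Proof.
have K0 := K_gt0; set j := v %/ s.
suff : count (fun c => occupied c && (v \in bucket c)) (iota 0 (k * K)) <=
    count (fun i : nat => (i == j) || odd ((j < i) + i + j)) (iota 0 k).
  by have := count_toward j k; lia.
rewrite -!size_filter -(size_map (divn^~ K)); apply: uniq_leq_size => [|x].
  rewrite map_inj_in_uniq ?filter_uniq ?iota_uniq // => c d.
  rewrite !mem_filter !mem_iota !add0n => /and3P[/andP[_ vc] _ ck] /and3P[/andP[_ vd] _ dk] e.
  move: vc vd; rewrite !mem_bucket // => /andP[_ /eqP sc] /andP[_ /eqP sd].
  by rewrite (divn_eq c K) (divn_eq d K) -sc -sd e.
case/mapP => c; rewrite mem_filter mem_iota add0n => /and3P[/andP[gc vc] _ ck] ->.
rewrite mem_filter mem_iota add0n ltn_divLR // ck andbT leq0n andbT.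
have /occupiedP[u [_ [ul _]]] := gc; have [uv ->] := cell_directed ck ul vc.
rewrite cell_div; case/andP: uv => _; rewrite /orient -/j.
have [//|ne] := eqVneq (u %/ s) j; suff -> : (v <= u) = (j < u %/ s) by [].
case: (leqP v u) => [vu | uv]; first by rewrite ltn_neqAle eq_sym ne leq_div2r.
by rewrite ltnNge (leq_div2r _ (ltnW uv)).
Qed.

Definition load_bound : nat := K + (k %/ 2 + 2).

Lemma load_signature_partition (v : 'I_n) : load signature_partition v <= load_bound.
Proof.
have -> : load signature_partition v =
    #|[set b in [seq biclique c | c <- occupied_cells & v \in bverts (biclique c)]]|.
  congr #|pred_of_set _|; apply/setP => b; rewrite [LHS]inE [RHS]inE [b \in signature_partition]inE.
  apply/andP/mapP => [[/mapP[c cc ->] vb] | [c]]; first by exists c; rewrite // mem_filter vb.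
  by rewrite mem_filter => /andP[vb cc] ->; rewrite vb map_f.
rewrite cardsE; apply: leq_trans (card_size _) _; rewrite size_map size_filter count_filter.
apply: leq_trans (_ : count (predU (fun c => val v \in left_side c)
  (fun c => occupied c && (val v \in bucket c))) (iota 0 (k * K)) <= _).
  by apply: sub_count => c /=; rewrite !inE !mem_ords => /andP[/orP[->|->] ->]; rewrite ?orbT.
by apply: leq_trans (leq_add (left_load v) (right_load v)); rewrite -count_predUI leq_addr.
Qed.

Lemma lists_signature_partition : lists_bicliques biclique_lists signature_partition.
Proof.
have uc : uniq occupied_cells by rewrite filter_uniq ?iota_uniq.
apply/andP; split.
  apply/allP => _ /mapP[c _ ->] /=; rewrite !pmap_sub_uniq ?bucket_uniq //.
  by rewrite filter_uniq ?iota_uniq.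
rewrite -map_comp; apply: uniq_perm; last by move=> b; rewrite mem_enum inE.
  rewrite map_inj_in_uniq // => c d; rewrite !mem_occupied_cells => /andP[ck gc] /andP[dk gd] e.
  have [u [v [_ ul vb]]] := occupied_edge ck gc.
  have ec : [set u; v] \in bedges (biclique c) by apply/imset2P; exists u v.
  have {}e : biclique c = biclique d := e.
  by apply: (bedges_inj ck dk ec); rewrite -e.
exact: enum_uniq.
Qed.

Lemma code_signature_partition : bicliques_code biclique_lists = program_output G.
Proof.
rewrite /bicliques_code /program_output /emitted size_map; congr (_ :: flatten _).
rewrite -map_comp; apply/eq_in_map => c; rewrite mem_occupied_cells => /andP[ck gc] /=.
have bn : all (gtn n) (bucket c) by apply/allP => v /bucket_bound.
have ln : all (gtn n) (left_side c).
  have /occupiedP[_ [v [_ vb]]] := gc.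
  by apply/allP => u ul; have [/directed_lt/andP[]] := cell_directed ck ul vb.
by rewrite map_cat !val_ords // -{1}(size_map val) -(size_map val (ords (bucket c))) !val_ords.
Qed.

End Partition.

Lemma lbp_le (T : finType) (H : sgraph T) (P : {set bipair T}) b :
  is_biclique_partition H P -> (forall v, load P v <= b) -> lbp H <= b.
Proof.
move=> HP Hb; rewrite /lbp; case: ex_minnP => m _; apply.
by apply/existsP; exists P; rewrite HP; apply/forallP.
Qed.

Lemma lbpn_le n : lbpn n <= load_bound n.
Proof.
apply/bigmax_leqP => G _; apply: lbp_le (signature_partitionP G) _ => v.
exact: load_signature_partition.
Qed.

(** * Asymptotics *)

(** With l the integer logarithm of n and l' that of l, the left factor is 2 ^ (l + 1)
divided by 4 ^ l', and 2 ^ (l' + 1) is at least l + 1. *)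
Lemma exp_group_size n : 0 < n -> 2 ^ group_size n * (trunc_log 2 n).+1 ^ 2 <= 8 * n.
Proof.
move=> n0; rewrite /group_size; set l := trunc_log 2 n; set ll := trunc_log 2 l.
have ln : 2 ^ l <= n by apply: trunc_logP.
have l1 : l.+1 ^ 2 <= 4 * 2 ^ (ll + ll).
  rewrite expnD mulnn -[4]/(2 ^ 2) -expnMn leq_exp2r // -expnS.
  exact: trunc_log_ltn.
apply: leq_trans (leq_mul (leqnn _) l1) _.
rewrite mulnCA -expnD subnK; last by have := double_log_le l; rewrite -/ll; lia.
by rewrite expnD expn1; lia.
Qed.

Lemma log_sqr_le n : 0 < n -> (trunc_log 2 n).+1 ^ 2 <= 4 * n.
Proof.
move=> n0; have := trunc_logP (isT : 1 < 2) n0; move: (trunc_log 2 n) => l ln.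
apply: leq_trans (_ : 4 * 2 ^ l <= _); last by rewrite leq_mul2l ln orbT.
elim: l {ln} => [|[|[|l]] IH] //; rewrite [2 ^ _]expnS !expnS !expn0 in IH *; nia.
Qed.

(** The group size is at least half of lg n once 4 lg l is at most l. *)
Lemma log_le_group_size n : 16 <= trunc_log 2 n ->
  trunc_log 2 n + 2 <= 2 * group_size n.
Proof.
rewrite /group_size; set l := trunc_log 2 n; set ll := trunc_log 2 l => l16.
have ll4 : 4 <= ll by apply: (@trunc_log_max 2 l 4).
have : 2 ^ ll <= l by apply: trunc_logP => //; lia.
suff : 4 * ll <= 2 ^ ll by lia.
rewrite -(subnK ll4); elim: (ll - 4) => // d IH.
by rewrite addSn expnS; lia.
Qed.

Lemma half_bounds k : 2 * (k %/ 2) <= k <= 2 * (k %/ 2) + 1.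
Proof. by lia. Qed.

(* Loaded only here, because classical sets shadow the finite ones. *)
From mathcomp Require Import all_boot all_order all_algebra.
From mathcomp Require Import all_classical all_reals all_analysis.
From mathcomp Require Import ring lra.

Import Order.TTheory GRing.Theory Num.Theory.
Import numFieldNormedType.Exports.
Local Open Scope classical_set_scope.
Local Open Scope ring_scope.

Section Asymptotics.
Variable R : realType.
Implicit Types (x y : R) (m n : nat).

Lemma ln2_gt0 : 0 < ln (2 : R).
Proof. by apply: ln_gt0; rewrite ltr1n. Qed.

Lemma lg_le x y : 0 < x -> x <= y -> lg x <= lg y.
Proof.
move=> x0 xy; rewrite /lg ler_pM2r ?invr_gt0 ?ln2_gt0 // ler_ln ?posrE //.
exact: lt_le_trans xy.
Qed.

Lemma lg_lt x y : 0 < x -> x < y -> lg x < lg y.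
Proof.
move=> x0 xy; rewrite /lg ltr_pM2r ?invr_gt0 ?ln2_gt0 // ltr_ln ?posrE //.
exact: lt_trans xy.
Qed.

Lemma lg_exp2 m : lg (2 ^ m)%N%:R = m%:R :> R.
Proof.
rewrite /lg natrX lnXn ?ltr0n // -[ln 2 *+ m]mulr_natl mulfK //.
by rewrite gt_eqF ?ln2_gt0.
Qed.

Lemma lg_trunc_log m : (0 < m)%N ->
  (trunc_log 2 m)%:R <= lg (m%:R : R) < (trunc_log 2 m).+1%:R.
Proof.
move=> m0; apply/andP; split.
  rewrite -[X in X <= _]lg_exp2; apply: lg_le; rewrite ?ltr0n ?expn_gt0 // ler_nat.
  exact: trunc_logP.
by rewrite -[X in _ < X]lg_exp2; apply: lg_lt; rewrite ?ltr0n // ltr_nat trunc_log_ltn.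
Qed.

(** All that the asymptotic bounds use about the rounding of logarithms. The bound
2 ^ 16 on n makes the integer logarithm at least 16, from which on
[log_le_group_size] holds. *)
Lemma estimates n (x := lg (n%:R : R)) (y := lg x) : (2 ^ 16 <= n)%N ->
  [/\ 16 <= x, 1 <= y, x <= n%:R, x ^+ 2 <= 4 * n%:R &
  [/\ (group_size n)%:R <= x, x <= 2 * (group_size n)%:R,
      x - 2 * y <= (group_size n)%:R & (2 ^ group_size n)%N%:R * x ^+ 2 <= 8 * n%:R]].
Proof.
move=> n16; have n0 : (0 < n)%N by lia.
have l16 : (16 <= trunc_log 2 n)%N by apply: trunc_log_max.
have /andP[lx xl] := lg_trunc_log n0; rewrite -/x in lx xl.
have x16 : 16 <= x by apply: le_trans lx; rewrite ler_nat.
set l := trunc_log 2 n in l16 lx xl *.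
have ll4 : (4 <= trunc_log 2 l)%N by apply: (@trunc_log_max 2 l 4).
have lly : (trunc_log 2 l)%:R <= y.
  have l0 : (0 < l)%N by lia.
  have /andP[h _] := lg_trunc_log l0; apply: le_trans h _.
  by apply: lg_le => //; rewrite ltr0n.
have ll : (l.+1 <= n)%N.
  by apply: leq_trans (ltn_expl _ _) (trunc_logP _ n0).
have x2l : x ^+ 2 <= (l.+1 ^ 2)%N%:R.
  by rewrite natrX; apply: lerXn2r (ltW xl); rewrite ?nnegrE ?ler0n //; lra.
have dl := double_log_le l.
have sE : (group_size n + 2 * trunc_log 2 l = l + 1)%N by rewrite /group_size -/l; lia.
have {}sE : (group_size n)%:R + 2 * (trunc_log 2 l)%:R = l%:R + 1 :> R.
  by move/(congr1 (fun i => i%:R : R)): sE; rewrite natrD natrM natrD.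
have ll4' : 4 <= (trunc_log 2 l)%:R :> R by rewrite ler_nat.
have hs : (l + 2)%:R <= (2 * group_size n)%:R :> R by rewrite ler_nat log_le_group_size.
rewrite natrD natrM in hs; rewrite -addn1 natrD in xl.
split=> //.
- by lra.
- by apply: le_trans (ltW xl) _; rewrite -natrD addn1 ler_nat.
- by apply: le_trans x2l _; rewrite -natrM ler_nat log_sqr_le.
split.
- by lra.
- by lra.
- by lra.
apply: le_trans (_ : (2 ^ group_size n * l.+1 ^ 2)%N%:R <= _).
  by rewrite natrM ler_wpM2l ?ler0n.
by rewrite -natrM ler_nat exp_group_size.
Qed.

Lemma group_count_bounds n :
  n%:R <= (group_count n)%:R * (group_size n)%:R :> R /\
  ((group_count n)%:R - 1) * (group_size n)%:R <= n%:R :> R.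
Proof.
have s0 := group_size_gt0 n; rewrite /group_count natrD addrK; split.
  by rewrite -natrD -natrM ler_nat addn1 ltnW // ltn_ceil.
by rewrite -natrM ler_nat leq_divM.
Qed.

(** The error term is the exact difference between the load bound and the main
term, so that the load is bounded by their sum for every n. *)
Definition load_error n : R := (load_bound n)%:R - 2^-1 * (n%:R / lg n%:R).

Definition count_bound n : R := (group_count n * 2 ^ group_size n)%N%:R.

(** Write x = lg n, y = lg x, u = 1 / x and t = 1 / s. Then k / 2 is n t / 2 up to a
constant, and t - u = (x - s) t u is at most 4 y u^2, because x - s is at most
2 y and t at most 2 u. The summand K and the constants are O(n u^2), and y is at
least 1. The error is nonnegative since s is at most x. *)
Lemma load_error_bigO :
  load_error =O_\oo (fun n : nat => n%:R * lg (lg n%:R) / lg n%:R ^+ 2 : R).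
Proof.
apply/eqO_exP; exists 20; first by rewrite ltr0n.
exists (2 ^ 16)%N => // n /= n16.
have [] := estimates n16; have [] := group_count_bounds n.
have /andP[ke' ke] := half_bounds (group_count n).
rewrite /load_error; set N := n%:R : R; set x := lg N; set y := lg x; set s := (group_size n)%:R.
move=> kN Nk x16 y1 xN x2N [sx x2s xys KN].
have kE : (group_count n)%:R <= 2 * (group_count n %/ 2)%:R + 1 :> R.
  by rewrite -natrM -[1]/(1%:R) -natrD ler_nat.
have kE' : 2 * (group_count n %/ 2)%:R <= (group_count n)%:R :> R.
  by rewrite -natrM ler_nat.
rewrite /load_bound !natrD; move: kN Nk kE kE' KN.
set k := (group_count n)%:R; set K := (2 ^ _)%N%:R : R; set k2 := (_ %/ 2)%:R.
move=> kN Nk kE kE' KN.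
have K0 : 0 <= K by rewrite /K ler0n.
have x0 : 0 < x by lra.
have s0 : 0 < s by lra.
have N0 : 0 < N by lra.
set u := x^-1; set t := s^-1.
have xu : x * u = 1 by rewrite mulfV // gt_eqF.
have st : s * t = 1 by rewrite mulfV // gt_eqF.
have u0 : 0 < u by rewrite invr_gt0.
have t0 : 0 < t by rewrite invr_gt0.
have t2u : t <= 2 * u by nra.
have ut : u <= t by nra.
have tu : t - u <= 4 * y * u ^+ 2.
  have -> : t - u = (x - s) * (t * u) by nra.
  apply: le_trans (_ : (2 * y) * (t * u) <= _).
    by apply: ler_wpM2r; [rewrite mulr_ge0 // ltW | lra].
  have : 0 <= y * u * (2 * u - t) by rewrite mulr_ge0 ?subr_ge0 // mulr_ge0 ?ltW //; lra.
  lra.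
have Ku : K <= 8 * N * u ^+ 2.
  have -> : K = K * x ^+ 2 * u ^+ 2 by rewrite -mulrA -exprMn xu expr1n mulr1.
  by rewrite ler_wpM2r // exprn_ge0 // ltW.
have Nu : 1 <= 4 * N * u ^+ 2.
  apply: le_trans (_ : x ^+ 2 * u ^+ 2 <= _); first by rewrite -exprMn xu expr1n.
  by rewrite ler_wpM2r // exprn_ge0 // ltW.
have kt : k - 1 <= N * t.
  have -> : k - 1 = (k - 1) * s * t by rewrite -mulrA st mulr1.
  by rewrite ler_wpM2r // ltW.
have kt' : N * t <= k.
  have -> : k = k * s * t by rewrite -mulrA st mulr1.
  by rewrite ler_wpM2r // ltW.
have Nu0 : 0 < N * u ^+ 2 by rewrite mulr_gt0 // exprn_gt0.
have Ny : N * u ^+ 2 <= N * u ^+ 2 * y by nra.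
have Ntu : N * (t - u) <= 4 * (N * u ^+ 2 * y).
  apply: le_trans (_ : N * (4 * y * u ^+ 2) <= _); first by rewrite ler_pM2l.
  by rewrite (_ : N * _ = 4 * (N * u ^+ 2 * y)) //; ring.
have Nut : N * u <= N * t by rewrite ler_pM2l.
rewrite -[(x ^+ 2)^-1]exprVn -/u (_ : N * y * u ^+ 2 = N * u ^+ 2 * y); last by ring.
rewrite mulrBr in Ntu.
rewrite !ger0_norm; [lra | | lra].
by rewrite mulr_ge0 //; lra.
Qed.

Lemma count_bound_bigO :
  count_bound =O_\oo (fun n : nat => n%:R ^+ 2 / lg n%:R ^+ 3 : R).
Proof.
apply/eqO_exP; exists 24; first by rewrite ltr0n.
exists (2 ^ 16)%N => // n /= n16.
have [] := estimates n16; have [] := group_count_bounds n.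
rewrite /count_bound natrM; set N := n%:R : R; set x := lg N; set y := lg x.
set s := (group_size n)%:R; set k := (group_count n)%:R; set K := (2 ^ _)%N%:R : R.
move=> kN Nk x16 y1 xN x2N [sx x2s xys KN].
have K0 : 0 <= K by rewrite /K ler0n.
have k0 : 0 <= k by rewrite /k ler0n.
have x0 : 0 < x by lra.
have s0 : 0 < s by lra.
have N0 : 0 < N by lra.
have x3 : 0 < x ^+ 3 by rewrite exprn_gt0.
rewrite !ger0_norm; [| by rewrite divr_ge0 // exprn_ge0 // ltW | by rewrite mulr_ge0].
rewrite mulrA ler_pdivlMr //.
have kx : k * x <= 3 * N by nra.
have -> : k * K * x ^+ 3 = (k * x) * (K * x ^+ 2) by ring.
apply: le_trans (_ : 3 * N * (8 * N) <= _); last by lra.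
by apply: ler_pM => //; [nra | rewrite mulr_ge0 // exprn_ge0 // ltW].
Qed.

End Asymptotics.

(** Eleven suffices because no number that occurs exceeds 4 n^9, and 4 is at most
n^2. *)
Lemma word_size_exp (R : realType) (n w : nat) : (0 < n)%N ->
  11%:R * lg (n%:R : R) <= w%:R -> (n ^ 11 <= 2 ^ w)%N.
Proof.
move=> n0 h; rewrite leqNgt; apply/negP => lt; move: h; rewrite leNgt => /negP; apply.
have -> : 11%:R * lg (n%:R : R) = lg (n ^ 11)%N%:R.
  by rewrite /lg natrX lnXn ?ltr0n // -[ln _ *+ _]mulr_natl mulrA.
rewrite -[X in X < _]lg_exp2; apply: lg_lt; first by rewrite ltr0n expn_gt0.
by rewrite ltr_nat.
Qed.

Lemma time_bigO (R : realType) :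
  (fun n : nat => (300 * n ^ 2)%N%:R : R) =O_\oo (fun n : nat => n%:R ^+ 2 : R).
Proof.
apply/eqO_exP; exists 300; first by rewrite ltr0n.
exists 0%N => // n _ /=; rewrite natrM natrX normrM.
by rewrite [`|300|]ger0_norm ?ler0n.
Qed.

(** * The theorem *)

Theorem mainTheorem6 (R : realType) :
  exists err num : nat -> R,
    let bound := fun n : nat => 2^-1 * (n%:R / lg n%:R) + err n in
    let good := fun (n : nat) (G : sgraph 'I_n) (P : {set bipair 'I_n}) =>
      [/\ is_biclique_partition G P,
          forall v : 'I_n, (load P v)%:R <= bound n
        & #|P|%:R <= num n] in
    [/\ err =O_\oo (fun n : nat => n%:R * lg (lg n%:R) / lg n%:R ^+ 2 : R),
        num =O_\oo (fun n : nat => n%:R ^+ 2 / lg n%:R ^+ 3 : R),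
        forall n : nat, (lbpn n)%:R <= bound n,
        forall (n : nat) (G : sgraph 'I_n), exists P, good n G P
      & exists (c0 : nat) (p : program), forall c1 : nat,
          exists time : nat -> R,
            time =O_\oo (fun n : nat => n%:R ^+ 2 : R) /\
            forall n w : nat, (1 < n)%N ->
              c0%:R * lg (n%:R : R) <= w%:R <= c1%:R * lg (n%:R : R) ->
              forall G : sgraph 'I_n, exists (t : nat) (P : {set bipair 'I_n}),
                [/\ t%:R <= time n, computes_partition w p G t P
                  & good n G P]].
Proof.
exists (@load_error R), (@count_bound R) => bound good.
have boundE n : bound n = (load_bound n)%:R by rewrite /bound /load_error addrC subrK.
have partition_good n (G : sgraph 'I_n) : good n G (signature_partition G).
  split; first exact: signature_partitionP.
    by move=> v; rewrite boundE ler_nat load_signature_partition.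
  by rewrite ler_nat card_signature_partition.
split.
- exact: load_error_bigO.
- exact: count_bound_bigO.
- by move=> n; rewrite boundE ler_nat lbpn_le.
- by move=> n G; exists (signature_partition G).
exists 11, main_program => c1; exists (fun n => (300 * n ^ 2)%N%:R).
split=> [|n w n1 /andP[wlo _] G]; first exact: time_bigO.
have [t tT rt] := main_program_runs G n1 (word_size_exp (ltnW n1) wlo).
exists t, (signature_partition G); split=> //; first by rewrite ler_nat.
exists (biclique_lists G); first exact: lists_signature_partition.
by rewrite code_signature_partition.
Qed.
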